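(* Let $f$ be a positive integer and for non-negative integers $n_1,\dots,n_f$ put $N_i:=n_i+n_{i+1}+\dots+n_f$ for $i=1,\dots,f$. Then for $|q|<1$, \[ \sum_{m,n,n_1,\dots,n_f\geq 0}\frac{q^{2m^2+6mn+6n^2+N_1^2+\dots+N_f^2}(q;q)_{n_f}}{(q;q)_m(q^3;q^3)_n(q;q)_{n_f-3n-2m}(q;q)_{n_1}\cdots(q;q)_{n_{f-1}}(q;q)_{2n_f}} =\frac{1}{(q;q)_\infty}\sum_{j=-\infty}^{\infty}\left(\frac{j+1}{3}\right)q^{(f+1)j^2} =\frac{(q^{f+1};q^{f+1})_\infty}{(q;q)_\infty}(-q^{3(f+1)};q^{3(f+1)})_\infty(-q^{2(f+1)},-q^{4(f+1)};q^{6(f+1)})_\infty. \]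
   Context: $(a;p)_n=\prod_{k=0}^{n-1}(1-ap^k)$ for a base $p$, $(a_1,\dots,a_k;p)_n=(a_1;p)_n\cdots(a_k;p)_n$, and for $|p|<1$, $(a;p)_\infty=\lim_{n\to\infty}(a;p)_n$. By convention $1/(q;q)_n=0$ for negative integers $n$, so summands with $n_f-3n-2m<0$ vanish. $\left(\frac{a}{3}\right)$ denotes the Jacobi symbol modulo 3: $0$ if $3\mid a$, $1$ if $a\equiv1\pmod 3$, $-1$ if $a\equiv 2\pmod 3$. *)

(* Defs.v *)
From HB Require Import structures.
From mathcomp Require Import all_boot all_order all_algebra finmap.
From mathcomp Require Import all_classical reals topology normedtype sequences.
From mathcomp Require summability.
From mathcomp Require Import complex.

Set Implicit Arguments.
Unset Strict Implicit.
Unset Printing Implicit Defensive.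

Import Order.TTheory GRing.Theory Num.Theory.
Import numFieldNormedType.Exports.

Local Open Scope classical_set_scope.
Local Open Scope ring_scope.

Definition qpoch (K : numFieldType) (a p : K) (n : nat) : K :=
  \prod_(k < n) (1 - a * p ^+ k).

Definition qpoch_inf (K : numFieldType) (a p : K) : K :=
  lim (qpoch a p n @[n --> \oo]).

(* 1 / (p; p)_k, with the convention that it is 0 for negative k *)
Definition inv_qpoch (K : numFieldType) (p : K) (k : int) : K :=
  match k with
  | Posz n => (qpoch p p n)^-1
  | Negz _ => 0
  end.

(* The Jacobi symbol (a / 3); (a %% 3)%Z is 0, 1 or 2 also for negative a. *)
Definition jacobi3 (a : int) : int :=
  if (a %% 3)%Z == 0 then 0 else if (a %% 3)%Z == 1 then 1 else -1.

(* Sums over an arbitrary index type are unordered: limits of the finite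
   partial sums along the inclusion order of finite subsets, which over the
   complex numbers amounts to absolute convergence. *)
Definition has_usum (K : numFieldType) (I : choiceType) (F : I -> K) : Prop :=
  cvg (summability.partial_sum F @ summability.totally).

Definition usum (K : numFieldType) (I : choiceType) (F : I -> K) : K :=
  summability.sum F.

(* ns = (n_1, ..., n_f), accessed with indices starting at 1 *)
Definition part (f : nat) (ns : f.-tuple nat) (i : nat) : nat :=
  nth 0%N ns i.-1.

Definition tail_sum (f : nat) (ns : f.-tuple nat) (i : nat) : nat :=
  (\sum_(i <= j < f.+1) part ns j)%N.

Definition multisum_term (K : numFieldType) (q : K) (f : nat)
    (x : nat * nat * f.-tuple nat) : K :=
  let: (m, n, ns) := x in
  let nf := part ns f in
  q ^+ (2 * m ^ 2 + 6 * m * n + 6 * n ^ 2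
        + \sum_(1 <= i < f.+1) tail_sum ns i ^ 2)%N
  * qpoch q q nf
  * inv_qpoch q (nf%:Z - 3 * n%:Z - 2 * m%:Z)
  / (qpoch q q m * qpoch (q ^+ 3) (q ^+ 3) n
     * (\prod_(1 <= i < f) qpoch q q (part ns i))
     * qpoch q q (2 * nf)%N).

Definition theta_term (K : numFieldType) (q : K) (f : nat) (j : int) : K :=
  (jacobi3 (j + 1))%:~R * q ^+ (f.+1 * `|j| ^ 2)%N.

(* Main.v *)
Require Import Defs.
From HB Require Import structures.
From mathcomp Require Import all_boot all_order all_algebra finmap.
From mathcomp Require Import all_classical reals topology normedtype sequences.
From mathcomp Require summability.
From mathcomp Require Import complex ring zify.

Set Implicit Arguments.
Unset Strict Implicit.
Unset Printing Implicit Defensive.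

Import Order.TTheory GRing.Theory Num.Theory.
Import numFieldNormedType.Exports.

(** Write c_j = ((j+1)/3). Any three consecutive c_j sum to 0, so the polynomials
    b_L = sum_j c_j q^(j^2) / ((q)_(L-j) (q)_(L+j)) satisfy a three-term
    recurrence in L (that of the continuous q-Hermite polynomials at 2x = 1, base 1/q).
    The Capparelli-type double sum (q)_L / (q)_(2L) sum_(m,n) q^(2m^2+6mn+6n^2) /
    ((q)_m (q^3;q^3)_n (q)_(L-3n-2m)) obeys the same recurrence: up to its
    prefactor it is the convolution with 1/(q)_k of g_k = sum_(2m+3n=k) q^(2m^2+6mn+6n^2) /
    ((q)_m (q^3;q^3)_n), and g satisfies an easy order-four recurrence which
    factors through an order-three one.  Hence both agree, i.e. they form a Bailey pair relative to 1.  Iterating the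
    Bailey lemma f times gives the multisum, truncated at N_1 <= L and weighted
    by 1/(q)_(L-N_1), as sum_j c_j q^((f+1)j^2) / ((q)_(L-j) (q)_(L+j)); letting L
    tend to infinity by dominated convergence yields the first equality.  The
    product formula is the Jacobi triple product at a cube root of unity; its
    finite form again only needs c_(j-1) + c_j + c_(j+1) = 0, and the factors
    1 - x + x^2 = (1 + x^3)/(1 + x) recombine into the stated product. *)

Local Open Scope classical_set_scope.
Local Open Scope ring_scope.
Local Open Scope complex_scope.

(** * Finite q-products and theta sums *)

Section QPochhammer.
Context (K : numFieldType).
Implicit Types (a p : K) (n : nat).

Lemma qpoch0 a p : qpoch a p 0 = 1.
Proof. by rewrite /qpoch big_ord0. Qed.

Lemma qpochS a p n : qpoch a p n.+1 = qpoch a p n * (1 - a * p ^+ n).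
Proof. by rewrite /qpoch big_ord_recr. Qed.

Lemma qpoch_neq0 p n : (forall k, 1 - p ^+ k.+1 != 0) -> qpoch p p n != 0.
Proof.
by move=> hp; rewrite prodf_seq_neq0; apply/allP => i _ /=; rewrite -exprS.
Qed.

End QPochhammer.

Section InvQPochhammer.
Context (K : numFieldType) (q : K).
Hypothesis q_neq1 : forall k, 1 - q ^+ k.+1 != 0.
Local Notation e := (inv_qpoch q).

Lemma inv_qpochS (n : nat) : (1 - q ^+ n.+1) * e n.+1%:Z = e n%:Z.
Proof.
by rewrite /= qpochS -exprS invfM mulrCA mulfV ?q_neq1 ?mulr1.
Qed.

Lemma inv_qpoch_lt0 (k : int) : k < 0 -> e k = 0.
Proof. by case: k. Qed.

Lemma inv_qpoch_pred (k : int) : (1 - q ^+ `|k|) * e k = e (k - 1).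
Proof.
case: k => [[|n]|n].
- by rewrite expr0 subrr mul0r.
- by rewrite absz_nat inv_qpochS; congr (e _); lia.
- by rewrite mulr0; apply/esym/inv_qpoch_lt0; lia.
Qed.

End InvQPochhammer.

Section IntegerSums.
Context (K : nzRingType).
Implicit Types (F : int -> K) (N : nat).

(** One window from [-N] to [N] serves all levels [L < N] at once, so that sums of different levels
    share an index range. The summands that matter vanish near its ends because [inv_qpoch] is 0 at
    negative arguments. *)
Definition zsum N F : K := \sum_(i < (2 * N).+1) F (i%:Z - N%:Z).

Lemma eq_zsum N F1 F2 : F1 =1 F2 -> zsum N F1 = zsum N F2.
Proof. by move=> eqF; apply: eq_bigr => i _. Qed.

Lemma zsumD N F1 F2 : zsum N (fun j => F1 j + F2 j) = zsum N F1 + zsum N F2.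
Proof. exact: big_split. Qed.

Lemma mulr_zsumr N F (x : K) : x * zsum N F = zsum N (fun j => x * F j).
Proof. by rewrite /zsum big_distrr. Qed.

Lemma zsum_shift N F : F (- N%:Z) = 0 -> F (N%:Z + 1) = 0 ->
  zsum N (fun j => F (j + 1)) = zsum N F.
Proof.
move=> F0 F1; rewrite /zsum big_ord_recr big_ord_recl /=.
have -> : (2 * N)%N%:Z - N%:Z + 1 = N%:Z + 1 by lia.
rewrite sub0r F0 F1 addr0 add0r; apply: eq_bigr => i _; congr F.
by rewrite /= /bump /=; lia.
Qed.

Lemma zsum_only0 N F : (forall j, j != 0 -> F j = 0) -> zsum N F = F 0.
Proof.
move=> F0.
have hN : (N < (2 * N).+1)%N by lia.
rewrite /zsum (bigD1 (Ordinal hN)) //= subrr big1 ?addr0 // => i ne.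
by apply: F0; apply: contra ne => /eqP h; apply/eqP/val_inj => /=; lia.
Qed.

End IntegerSums.

(** * Three-term recurrence for the theta polynomials *)

Section ThetaPolynomials.
Context (K : numFieldType) (q : K) (c : int -> K) (N : nat).
Hypothesis q_neq1 : forall k, 1 - q ^+ k.+1 != 0.
Hypothesis c_rec : forall j, c (j + 1) + c j + c (j - 1) = 0.
Local Notation e := (inv_qpoch q).

(** With [x = q^a] and [y = q^b] this is [1 - x y = x (1 - y) + y (1 - x) + (1 - x) (1 - y)], each
    factor [1 - x] or [1 - y] lowering an index by one. *)
Lemma inv_qpoch_rec (a b : int) :
  (1 - q ^+ (`|a| + `|b|)) * (e a * e b) =
  q ^+ `|a| * (e a * e (b - 1)) + q ^+ `|b| * (e (a - 1) * e b)
  + e (a - 1) * e (b - 1).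
Proof. rewrite -!(inv_qpoch_pred q_neq1) exprD; ring. Qed.

(** The two indices add up to [2L] in [evB] and to [2L - 1] in the companion [odB]. Passing through
    odd totals replaces a second-order recurrence by two first-order ones. *)
Let evB (L : int) (j : int) := q ^+ (`|j| ^ 2) * (e (L - j) * e (L + j)).
Let odB (L : int) (j : int) :=
  q ^+ `|j * (j + 1)| * (e (L - 1 - j) * e (L + j)).

Definition theta_poly (L : nat) : K := zsum N (fun j => c j * evB L j).
Let odd_poly (L : nat) : K := zsum N (fun j => (c j + c (j + 1)) * odB L j).

Let odB_rec (L : nat) j : (1 - q ^+ (2 * L).+1) * odB L.+1 j =
  q ^+ L * (evB L j + evB L (j + 1)) + odB L j.
Proof.
rewrite /odB /evB.
have -> : L.+1%:Z - 1 - j = L%:Z - j by lia.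
have -> : L.+1%:Z + j = L%:Z + j + 1 by lia.
have -> : L%:Z - (j + 1) = L%:Z - j - 1 by lia.
have -> : L%:Z + (j + 1) = L%:Z + j + 1 by lia.
have -> : L%:Z - 1 - j = L%:Z - j - 1 by lia.
have W := inv_qpoch_rec (L%:Z - j) (L%:Z + j + 1).
rewrite addrK in W.
(* Negative indices are set apart: there the absolute values no longer add up to [2L + 1], but both
   sides are 0. *)
have [alt|age] := ltP (L%:Z - j) 0.
  by rewrite ![e (L%:Z - j)]inv_qpoch_lt0 // ![e (L%:Z - j - 1)]inv_qpoch_lt0;
    [ring | lia].
have [blt|bge] := ltP (L%:Z + j + 1) 0.
  by rewrite ![e (L%:Z + j + 1)]inv_qpoch_lt0 // ![e (L%:Z + j)]inv_qpoch_lt0;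
    [ring | lia].
have Eab : (`|(L%:Z - j)%R| + `|(L%:Z + j + 1)%R| = (2 * L).+1)%N by lia.
rewrite Eab in W.
rewrite mulrCA W !mulrDr !mulrA -!exprD.
congr (_ + _ + _); congr (q ^+ _ * _ * _); nia.
Qed.

Let evB_rec (L : nat) j : (1 - q ^+ (2 * L).+2) * evB L.+1 j =
  q ^+ L.+1 * (odB L.+1 (j - 1) + odB L.+1 j) + evB L j.
Proof.
rewrite /odB /evB.
have -> : L.+1%:Z - 1 - j = L.+1%:Z - j - 1 by lia.
have -> : L.+1%:Z - 1 - (j - 1) = L.+1%:Z - j by lia.
have -> : L.+1%:Z + (j - 1) = L.+1%:Z + j - 1 by lia.
have -> : L%:Z - j = L.+1%:Z - j - 1 by lia.
have -> : L%:Z + j = L.+1%:Z + j - 1 by lia.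
have W := inv_qpoch_rec (L.+1%:Z - j) (L.+1%:Z + j).
have [alt|age] := ltP (L.+1%:Z - j) 0.
  by rewrite ![e (L.+1%:Z - j)]inv_qpoch_lt0 //
    ![e (L.+1%:Z - j - 1)]inv_qpoch_lt0; [ring | lia].
have [blt|bge] := ltP (L.+1%:Z + j) 0.
  by rewrite ![e (L.+1%:Z + j)]inv_qpoch_lt0 //
    ![e (L.+1%:Z + j - 1)]inv_qpoch_lt0; [ring | lia].
have Eab : (`|(L.+1%:Z - j)%R| + `|(L.+1%:Z + j)%R| = (2 * L).+2)%N by lia.
rewrite Eab in W.
rewrite mulrCA W !mulrDr !mulrA -!exprD.
congr (_ + _ + _); congr (q ^+ _ * _ * _); nia.
Qed.

Let odd_poly_rec L : (L < N)%N ->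
  (1 - q ^+ (2 * L).+1) * odd_poly L.+1 = q ^+ L * theta_poly L + odd_poly L.
Proof.
move=> ltLN; rewrite /odd_poly /theta_poly !mulr_zsumr.
have E j : (1 - q ^+ (2 * L).+1) * ((c j + c (j + 1)) * odB L.+1 j) =
   q ^+ L * ((c j + c (j + 1)) * evB L j)
   + q ^+ L * ((c (j + 1 - 1) + c (j + 1)) * evB L (j + 1))
   + (c j + c (j + 1)) * odB L j.
  by rewrite mulrCA odB_rec addrK; ring.
rewrite (eq_zsum N E) !zsumD.
rewrite (@zsum_shift _ N (fun j => q ^+ L * ((c (j - 1) + c j) * evB L j))).
- rewrite -zsumD; congr (_ + _); apply: eq_zsum => j.
  (* The relation on [c] enters here: the two weights [c_j + c_(j+1)] and [c_(j-1) + c_j] add up to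
     [c_j]. *)
  have -> : c (j - 1) = - (c (j + 1) + c j) by rewrite -[RHS]add0r -(c_rec j); ring.
  ring.
- by rewrite /evB [e (L%:Z + - N%:Z)]inv_qpoch_lt0 ?(mulr0, mul0r) //; lia.
- by rewrite /evB [e (_ - _)]inv_qpoch_lt0 ?(mulr0, mul0r) //; lia.
Qed.

Let even_poly_rec L : (L < N)%N ->
  (1 - q ^+ (2 * L).+2) * theta_poly L.+1
  = q ^+ L.+1 * odd_poly L.+1 + theta_poly L.
Proof.
move=> ltLN; rewrite /odd_poly /theta_poly !mulr_zsumr.
have E j : (1 - q ^+ (2 * L).+2) * (c j * evB L.+1 j) =
   q ^+ L.+1 * (c j * odB L.+1 (j - 1)) + q ^+ L.+1 * (c j * odB L.+1 j)
   + c j * evB L j.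
  by rewrite mulrCA evB_rec; ring.
rewrite (eq_zsum N E) !zsumD.
rewrite -(@zsum_shift _ N (fun j => q ^+ L.+1 * (c j * odB L.+1 (j - 1)))).
- rewrite -zsumD; congr (_ + _); apply: eq_zsum => j; rewrite addrK; ring.
- by rewrite /odB [e (_ + (- N%:Z - 1))]inv_qpoch_lt0 ?(mulr0, mul0r) //; lia.
- by rewrite /odB addrK [e (_ - _ - _)]inv_qpoch_lt0 ?(mulr0, mul0r) //; lia.
Qed.

Let odd_poly0 : odd_poly 0 = 0.
Proof.
rewrite /odd_poly /zsum big1 // => i _; rewrite /odB.
set j := (X in q ^+ `|X * _|).
have [jlt|jge] := ltP j 0.
  by rewrite [e (0%:Z + j)]inv_qpoch_lt0 ?(mulr0, mul0r) //; lia.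
by rewrite [e (0%:Z - 1 - j)]inv_qpoch_lt0 ?(mulr0, mul0r) //; lia.
Qed.

Lemma theta_poly0 : theta_poly 0 = c 0.
Proof.
rewrite /theta_poly zsum_only0 => [|j jn0].
  by rewrite /evB /= /qpoch big_ord0 invr1; ring.
rewrite /evB; have [jlt|jge] := ltP j 0.
  by rewrite [e (0%:Z + j)]inv_qpoch_lt0 ?(mulr0, mul0r) //; lia.
by rewrite [e (0%:Z - j)]inv_qpoch_lt0 ?(mulr0, mul0r) //; lia.
Qed.

Lemma theta_poly1 : (0 < N)%N -> (1 - q) * (1 - q ^+ 2) * theta_poly 1 = c 0.
Proof.
move=> N0; have := even_poly_rec N0; have := odd_poly_rec N0.
rewrite odd_poly0 theta_poly0 !muln0 !expr1 expr0 mul1r addr0 => h1 h2.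
by rewrite -mulrA h2 mulrDr mulrCA h1; ring.
Qed.

(** The odd polynomials are eliminated: the even step expresses [q^(L+1)] times the odd polynomial
    through two consecutive even ones. *)
Lemma theta_poly_rec L : (L.+1 < N)%N ->
  (1 - q ^+ (2 * L).+3) * (1 - q ^+ (2 * L).+4) * theta_poly L.+2 =
  (1 + q - q ^+ (2 * L).+3) * theta_poly L.+1 - q * theta_poly L.
Proof.
move=> lt1; have lt0 := ltnW lt1.
have := even_poly_rec lt1; have := even_poly_rec lt0; have := odd_poly_rec lt1.
rewrite !mulnS !add2n => h1 h0 h2.
rewrite -mulrA h2 mulrDr mulrCA h1 mulrDr.
have -> : q ^+ L.+2 * odd_poly L.+1
    = q * ((1 - q ^+ (2 * L).+2) * theta_poly L.+1 - theta_poly L).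
  by rewrite h0 exprS; ring.
have -> : q ^+ L.+2 * (q ^+ L.+1 * theta_poly L.+1)
    = q ^+ (2 * L).+3 * theta_poly L.+1.
  by rewrite mulrA -exprD; congr (q ^+ _ * _); lia.
rewrite [q ^+ (2 * L).+3]exprS; ring.
Qed.

End ThetaPolynomials.

(** * A finite Jacobi triple product at a cube root of unity *)

Section FiniteTripleProduct.
Context (K : numFieldType) (Q : K) (c : int -> K) (N : nat).
Hypothesis Q_neq1 : forall k, 1 - (Q ^+ 2) ^+ k.+1 != 0.
Hypothesis c_rec : forall j, c (j + 1) + c j + c (j - 1) = 0.
Local Notation p := (Q ^+ 2).
Local Notation e := (inv_qpoch p).

Let B (L : int) (j : int) := Q ^+ (`|j| ^ 2) * (e (L - j) * e (L + j)).

(** A Pascal rule lowering the total [a + b] by two. The difference [a - b] changes by 0, 2 or -2,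
    so for [a = L - j] and [b = L + j] the index [j] moves by at most one. *)
Let inv_qpoch_pred2 (a b : int) (n : nat) : (`|a| + `|b| = n.+1)%N ->
  (1 - p ^+ n) * (1 - p ^+ n.+1) * (e a * e b) =
  (1 + p ^+ n) * (e (a - 1) * e (b - 1))
  + p ^+ `|a| * (e a * e (b - 1 - 1)) + p ^+ `|b| * (e (a - 1 - 1) * e b).
Proof.
have [alt|age] := ltP a 0.
  by rewrite [e a]inv_qpoch_lt0 // [e (a - 1)]inv_qpoch_lt0
    ?[e (a - 1 - 1)]inv_qpoch_lt0 ?(mulr0, mul0r, addr0) //; lia.
have [blt|bge] := ltP b 0.
  by rewrite [e b]inv_qpoch_lt0 // [e (b - 1)]inv_qpoch_lt0
    ?[e (b - 1 - 1)]inv_qpoch_lt0 ?(mulr0, mul0r, addr0) //; lia.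
case: a age => // a _; case: b bge => // b _; rewrite !absz_nat => Eab.
(* The truncated predecessor does no harm: at [k = 0] the factor [1 - p^k] is 0, and so is the left
   side. *)
have e2 (k : nat) : e (k%:Z - 1 - 1) = (1 - p ^+ k.-1) * (1 - p ^+ k) * e k.
  case: k => [|k]; first by rewrite subrr mulr0 mul0r inv_qpoch_lt0.
  rewrite -!(inv_qpoch_pred Q_neq1) absz_nat.
  have -> : k.+1%:Z - 1 = k by lia.
  by rewrite absz_nat mulrA.
rewrite !e2 -!(inv_qpoch_pred Q_neq1) !absz_nat.
move: Eab; case: a => [|a]; case: b => [|b] //=.
- by rewrite add0n => -[->]; rewrite expr0; ring.
- by rewrite addn0 => -[->]; rewrite expr0; ring.
rewrite addnS => -[<-]; rewrite addSn !exprSr !exprD; ring.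
Qed.

Let B_rec (L : nat) j : (1 - p ^+ (2 * L).+1) * (1 - p ^+ (2 * L).+2) * B L.+1 j =
  (1 + p ^+ (2 * L).+1) * B L j + Q ^+ (2 * L).+1 * (B L (j - 1) + B L (j + 1)).
Proof.
rewrite /B.
have -> : L%:Z - (j - 1) = L.+1%:Z - j by lia.
have -> : L%:Z + (j - 1) = L.+1%:Z + j - 1 - 1 by lia.
have -> : L%:Z - (j + 1) = L.+1%:Z - j - 1 - 1 by lia.
have -> : L%:Z + (j + 1) = L.+1%:Z + j by lia.
have -> : L%:Z - j = L.+1%:Z - j - 1 by lia.
have -> : L%:Z + j = L.+1%:Z + j - 1 by lia.
have W := @inv_qpoch_pred2 (L.+1%:Z - j) (L.+1%:Z + j) (2 * L).+1.
have [alt|age] := ltP (L.+1%:Z - j) 0.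
  by rewrite [e (L.+1%:Z - j)]inv_qpoch_lt0 // [e (L.+1%:Z - j - 1)]inv_qpoch_lt0
    ?[e (L.+1%:Z - j - 1 - 1)]inv_qpoch_lt0 ?(mulr0, mul0r, addr0) //; lia.
have [blt|bge] := ltP (L.+1%:Z + j) 0.
  by rewrite [e (L.+1%:Z + j)]inv_qpoch_lt0 // [e (L.+1%:Z + j - 1)]inv_qpoch_lt0
    ?[e (L.+1%:Z + j - 1 - 1)]inv_qpoch_lt0 ?(mulr0, mul0r, addr0) //; lia.
rewrite mulrCA W; last by lia.
rewrite !mulrDr addrA -!exprM.
congr (_ + _ + _); first by rewrite mulrCA.
  by rewrite !mulrA -!exprD; congr (Q ^+ _ * _ * _); nia.
by rewrite !mulrA -!exprD; congr (Q ^+ _ * _ * _); nia.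
Qed.

Definition theta_sum (L : nat) : K := zsum N (fun j => c j * B L j).

Let theta_sum_rec L : (L.+1 < N)%N ->
  (1 - p ^+ (2 * L).+1) * (1 - p ^+ (2 * L).+2) * theta_sum L.+1 =
  (1 - Q ^+ (2 * L).+1 + (Q ^+ (2 * L).+1) ^+ 2) * theta_sum L.
Proof.
move=> ltLN; rewrite /theta_sum !mulr_zsumr.
have E j : (1 - p ^+ (2 * L).+1) * (1 - p ^+ (2 * L).+2) * (c j * B L.+1 j) =
   (1 + p ^+ (2 * L).+1) * (c j * B L j)
   + Q ^+ (2 * L).+1 * (c (j - 1 + 1) * B L (j - 1))
   + Q ^+ (2 * L).+1 * (c (j + 1 - 1) * B L (j + 1)).
  by rewrite mulrCA B_rec (subrK 1 j) (addrK 1 j); ring.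
rewrite (eq_zsum N E) !zsumD.
rewrite -(@zsum_shift _ N (fun j => Q ^+ (2 * L).+1 * (c (j - 1 + 1) * B L (j - 1)))).
- rewrite (@zsum_shift _ N (fun j => Q ^+ (2 * L).+1 * (c (j - 1) * B L j))).
  + rewrite -!zsumD; apply: eq_zsum => j; rewrite (addrK 1 j).
    (* Since [c_(j-1) + c_(j+1) = - c_j], the neighbour terms become a multiple of the middle one,
       and the whole sum gains the factor [1 - x + x^2] with [x = Q^(2L+1)]. *)
    have -> : c (j - 1) = - (c (j + 1) + c j) by rewrite -[RHS]add0r -(c_rec j); ring.
    by rewrite exprAC; ring.
  + by rewrite /B [e (L%:Z + - N%:Z)]inv_qpoch_lt0 ?(mulr0, mul0r) //; lia.
  + by rewrite /B [e (L%:Z - (N%:Z + 1))]inv_qpoch_lt0 ?(mulr0, mul0r) //; lia.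
- by rewrite /B [e (L%:Z + (- N%:Z - 1))]inv_qpoch_lt0 ?(mulr0, mul0r) //; lia.
- by rewrite /B (addrK 1 N%:Z) [e (L%:Z - N%:Z)]inv_qpoch_lt0 ?(mulr0, mul0r) //; lia.
Qed.

(** For [c_j = z^j] the triple product has the factors [(1 + z x) (1 + x/z)] with [x = Q^(2k+1)],
    which are [1 - x + x^2] when [z + 1/z = -1]. *)
Lemma theta_sum_prod L : (L < N)%N -> qpoch p p (2 * L) * theta_sum L =
  c 0 * \prod_(k < L) (1 - Q ^+ (2 * k).+1 + (Q ^+ (2 * k).+1) ^+ 2).
Proof.
elim: L => [|L IH] ltLN.
  rewrite muln0 qpoch0 big_ord0 mul1r mulr1 /theta_sum zsum_only0 => [|j jn0].
    by rewrite /B /= /qpoch big_ord0 invr1; ring.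
  rewrite /B; have [jlt|jge] := ltP j 0.
    by rewrite [e (0%:Z + j)]inv_qpoch_lt0 ?(mulr0, mul0r) //; lia.
  by rewrite [e (0%:Z - j)]inv_qpoch_lt0 ?(mulr0, mul0r) //; lia.
rewrite big_ord_recr /= mulrA -IH 1?ltnW // mulnS add2n !qpochS -!exprS.
rewrite -!mulrA [(1 - p ^+ _) * (_ * _)]mulrA theta_sum_rec //.
by rewrite [theta_sum L * _]mulrC.
Qed.

End FiniteTripleProduct.

Local Arguments inv_qpoch : simpl never.

(** * The Bailey lemma relative to 1 *)

Section BaileyLemma.
Context (K : numFieldType) (q : K).
Hypothesis q_neq1 : forall k, 1 - q ^+ k.+1 != 0.
Local Notation e := (inv_qpoch q).

(** A q-Chu-Vandermonde sum. Splitting [1 - q^(M+1) = q^i (1 - q^(M+1-i)) + (1 - q^i)] lowers either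
    [M + 1 - i] or [i]; the two parts recombine into the sum for [M] and [a + 1], which is why [a]
    stays free in the induction. *)
Lemma q_vandermonde (M a : nat) :
  \sum_(i < M.+1) q ^+ (i * (i + a)) * e (M - i)%N%:Z * e i%:Z * e (i + a)%N%:Z
  = e M%:Z * e (M + a)%N%:Z.
Proof.
elim: M a => [|M IH] a.
  by rewrite big_ord_recl big_ord0 subn0 mul0n expr0 mul1r addr0 /inv_qpoch qpoch0 invr1 mul1r.
apply: (mulfI (q_neq1 M)).
rewrite mulrA inv_qpochS // addSnnS -IH mulr_sumr.
pose G i := q ^+ (i * (i + a)) * e (M.+1 - i)%N%:Z * e i%:Z * e (i + a)%N%:Z.
have -> : \sum_(i < M.+2) (1 - q ^+ M.+1) * G i =
    \sum_(i < M.+2) (q ^+ i * (1 - q ^+ (M.+1 - i))) * G i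
    + \sum_(i < M.+2) (1 - q ^+ i) * G i.
  rewrite -big_split /=; apply: eq_bigr => i _.
  have {1}-> : M.+1 = (i + (M.+1 - i))%N by have := ltn_ord i; lia.
  by rewrite exprD; ring.
rewrite big_ord_recr /= subnn expr0 subrr mulr0 mul0r addr0.
rewrite [in X in _ + X]big_ord_recl /= expr0 subrr mul0r add0r -big_split /=.
apply: eq_bigr => i _; rewrite /G.
have ltiM := ltn_ord i.
rewrite /bump leq0n add1n addnS addSn subSS.
have -> : (M.+1 - i = (M - i).+1)%N by lia.
rewrite -!(inv_qpochS q_neq1 (M - i)) -(inv_qpochS q_neq1 i) -(inv_qpochS q_neq1 (i + a)).
have -> : (i.+1 * (i + a).+1 = i * (i + a) + i + (i + a).+1)%N by lia.
have -> : (i * (i + a).+1 = i * (i + a) + i)%N by lia.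
by rewrite !exprD; ring.
Qed.

(** By the symmetry between [j] and [-j] one may take [j >= 0]. Terms with [r < j] vanish, and
    [r = i + j] turns the others into the Vandermonde sum with [M = L - j] and [a = 2j]. *)
Lemma bailey_lemma (L : nat) (j : int) :
  \sum_(r < L.+1) q ^+ (r ^ 2) * e (L - r)%N%:Z * (e (r%:Z - j) * e (r%:Z + j))
  = q ^+ (`|j| ^ 2) * (e (L%:Z - j) * e (L%:Z + j)).
Proof.
wlog j_ge0 : j / 0 <= j => [hw|].
  have [/hw//|jlt0] := leP 0 j.
  have jN : 0 <= - j by lia.
  rewrite [X in _ = _ * X]mulrC; have := hw _ jN; rewrite abszN !opprK => <-.
  by apply: eq_bigr => r _; rewrite [X in _ = _ * X]mulrC.
case: j j_ge0 => // J _; rewrite absz_nat.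
have [ltLJ|leJL] := ltnP L J.
  rewrite [e (L%:Z - J%:Z)]inv_qpoch_lt0 ?(mul0r, mulr0); last by lia.
  rewrite big1 // => r _; have := ltn_ord r => ltr.
  by rewrite [e (r%:Z - J%:Z)]inv_qpoch_lt0 ?(mul0r, mulr0) //; lia.
rewrite -(big_mkord xpredT (fun r => q ^+ (r ^ 2) * e (L - r)%N%:Z
  * (e (r%:Z - J%:Z) * e (r%:Z + J%:Z)))).
rewrite (big_cat_nat (n := J)) //=; last by lia.
rewrite big_nat_cond big1 ?add0r; last first.
  by move=> r; rewrite andbT => ltr; rewrite [e (r%:Z - J%:Z)]inv_qpoch_lt0 ?(mul0r, mulr0) //; lia.
rewrite -{1}[J]add0n big_addn big_mkord subSn //.
have -> : L%:Z - J%:Z = (L - J)%N%:Z by lia.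
have -> : L%:Z + J%:Z = (L - J + (2 * J))%N%:Z by lia.
rewrite -q_vandermonde mulr_sumr; apply: eq_bigr => i _.
have -> : (i + J)%N%:Z - J%:Z = i%:Z by lia.
have -> : (i + J)%N%:Z + J%:Z = (i + 2 * J)%N%:Z by lia.
have -> : (L - (i + J) = L - J - i)%N by lia.
rewrite !mulrA -exprD; congr (q ^+ _ * _ * _ * _); lia.
Qed.

End BaileyLemma.

(** * The double sum *)

Section SequenceOperators.
Context (K : comNzRingType).
Implicit Types (u v w : nat -> K) (phi : nat -> nat -> K).

(** On generating functions [pad] is multiplication by the variable and [conv] is the product. *)
Definition pad u (k : nat) : K := if k is k'.+1 then u k' else 0.

Definition conv u v (k : nat) : K := \sum_(j < k.+1) u j * v (k - j)%N.

Lemma conv_lin a u v w k :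
  conv (fun j => u j + a * v j) w k = conv u w k + a * conv v w k.
Proof.
by rewrite /conv mulr_sumr -big_split /=; apply: eq_bigr => j _; ring.
Qed.

Lemma conv_padl u v k : conv (pad u) v k = pad (conv u v) k.
Proof.
rewrite /conv big_ord_recl mul0r add0r; case: k => [|k] /=.
  by rewrite big_ord0.
by apply: eq_bigr => j _; rewrite /bump leq0n add1n.
Qed.

Lemma conv_padr u v k : conv u (pad v) k = pad (conv u v) k.
Proof.
rewrite /conv big_ord_recr /= subnn /= mulr0 addr0; case: k => [|k] /=.
  by rewrite big_ord0.
by apply: eq_bigr => j _; rewrite subSn // -ltnS.
Qed.

Definition pair_sum phi (k : nat) : K :=
  \sum_(m < k.+1) \sum_(n < k.+1 | (2 * m + 3 * n == k)%N) phi m n.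

Lemma pair_sum_widen phi (k B C : nat) : (k < B)%N -> (k < C)%N ->
  pair_sum phi k = \sum_(m < B) \sum_(n < C | (2 * m + 3 * n == k)%N) phi m n.
Proof.
move=> ltkB ltkC; rewrite /pair_sum.
rewrite (big_ord_widen B (fun m => \sum_(n < k.+1 | (2 * m + 3 * n == k)%N) phi m n)) //.
rewrite big_mkcond /=; apply: eq_bigr => m _; case: ifPn => mk; last first.
  by rewrite big_pred0 // => n; apply/negbTE; apply: contra mk => /eqP; lia.
rewrite (big_ord_widen_cond C (fun n => (2 * m + 3 * n == k)%N) (phi m)) //.
apply: eq_bigl => n; case: eqP => //= h; lia.
Qed.

Lemma pair_sumD phi psi k :
  pair_sum (fun m n => phi m n + psi m n) k = pair_sum phi k + pair_sum psi k.
Proof.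
rewrite /pair_sum -big_split; apply: eq_bigr => m _; exact: big_split.
Qed.

Lemma eq_pair_sum phi psi k : (forall m n, phi m n = psi m n) ->
  pair_sum phi k = pair_sum psi k.
Proof. by move=> h; apply: eq_bigr => m _; apply: eq_bigr. Qed.

Lemma pair_sum_weight (F : nat -> K) phi k :
  pair_sum (fun m n => F (2 * m + 3 * n)%N * phi m n) k = F k * pair_sum phi k.
Proof.
rewrite /pair_sum mulr_sumr; apply: eq_bigr => m _.
by rewrite mulr_sumr; apply: eq_bigr => n /eqP->.
Qed.

(** Raising [m] by one raises [2m + 3n] by two, hence two shifts; raising [n] costs three. *)
Lemma pair_sum_padl phi k : (forall n, phi 0%N n = 0) ->
  pair_sum phi k = pad (pad (pair_sum (fun m n => phi m.+1 n))) k.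
Proof.
move=> phi0; have ltk : (k < k.+2)%N by lia.
rewrite (pair_sum_widen phi ltk ltk) big_ord_recl big1 // add0r.
case: k {ltk} => [|[|k]] /=.
- by rewrite big1 // => m _; rewrite big_pred0 // => n; rewrite /bump; lia.
- by rewrite big1 // => m _; rewrite big_pred0 // => n; rewrite /bump; lia.
rewrite (@pair_sum_widen _ k k.+3 k.+4); do ?lia.
apply: eq_bigr => m _; rewrite /bump leq0n add1n; apply: eq_bigl => n; lia.
Qed.

Lemma pair_sum_padr phi k : (forall m, phi m 0%N = 0) ->
  pair_sum phi k = pad (pad (pad (pair_sum (fun m n => phi m n.+1)))) k.
Proof.
move=> phi0; have ltk : (k < k.+2)%N by lia.
rewrite (pair_sum_widen phi ltk ltk).
have E (m : nat) :
    \sum_(n < k.+2 | (2 * m + 3 * n == k)%N) phi m n =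
    \sum_(n < k.+1 | (2 * m + 3 * n.+1 == k)%N) phi m n.+1.
  rewrite big_mkcond big_ord_recl /= phi0 if_same add0r [RHS]big_mkcond.
  by apply: eq_bigr => n _; rewrite /= /bump leq0n add1n.
under eq_bigr => m _ do rewrite E.
case: k {E ltk} => [|[|[|k]]] /=.
- by rewrite big1 // => m _; rewrite big_pred0 // => n; lia.
- by rewrite big1 // => m _; rewrite big_pred0 // => n; lia.
- by rewrite big1 // => m _; rewrite big_pred0 // => n; lia.
rewrite (@pair_sum_widen _ k k.+4.+1 k.+4); do ?lia.
apply: eq_bigr => m _; apply: eq_bigl => n; lia.
Qed.

End SequenceOperators.

(** * Recurrences for the Capparelli-type double sum *)

Section CapparelliSums.
Context (K : numFieldType) (q : K).
Hypothesis q_neq1 : forall k, 1 - q ^+ k.+1 != 0.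
Local Notation e := (inv_qpoch q).
Local Notation e3 := (inv_qpoch (q ^+ 3)).

Definition capp_term (m n : nat) : K :=
  q ^+ (2 * m ^ 2 + 6 * m * n + 6 * n ^ 2) * e m%:Z * e3 n%:Z.

Definition capp (k : nat) : K := pair_sum capp_term k.
(** The weight [q^m] arises from [1 - q^(2m) = (1 + q^m) (1 - q^m)] and is eliminated later through
    [capp_subg]. *)
Let gapp (k : nat) : K := pair_sum (fun m n => q ^+ m * capp_term m n) k.

Let q3_neq1 k : 1 - (q ^+ 3) ^+ k.+1 != 0.
Proof. by rewrite -exprM mulnS addSn. Qed.

Let capp_termSl m n : (1 - q ^+ m.+1) * capp_term m.+1 n =
  (q ^+ (2 * m + 3 * n)) ^+ 2 * q ^+ 2 * capp_term m n.
Proof.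
rewrite /capp_term -(inv_qpochS q_neq1 m).
have -> : (2 * m.+1 ^ 2 + 6 * m.+1 * n + 6 * n ^ 2 =
   2 * m ^ 2 + 6 * m * n + 6 * n ^ 2 + (2 * m + 3 * n) * 2 + 2)%N by lia.
rewrite 2!exprD exprM; ring.
Qed.

(** The factor [q^(2m)] makes the exponent gained depend on [2m + 3n] alone, so that it can be
    pulled out of [pair_sum]. *)
Let capp_termSr m n : q ^+ m ^+ 2 * (1 - q ^+ 3 ^+ n.+1) * capp_term m n.+1 =
  (q ^+ (2 * m + 3 * n)) ^+ 4 * q ^+ 6 * capp_term m n.
Proof.
rewrite /capp_term -(inv_qpochS q3_neq1 n).
set x := (2 * m ^ 2 + 6 * m * n + 6 * n ^ 2)%N; set y := (2 * m + 3 * n)%N.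
have E : q ^+ m ^+ 2 * q ^+ (2 * m ^ 2 + 6 * m * n.+1 + 6 * n.+1 ^ 2)
    = q ^+ y ^+ 4 * q ^+ 6 * q ^+ x.
  by rewrite -!exprM -!exprD; congr (q ^+ _); rewrite /x /y; lia.
have -> (z u v w : K) : z * u * (v * w * e3 n.+1%:Z) = z * v * u * w * e3 n.+1%:Z.
  by ring.
by rewrite E; ring.
Qed.

Let capp_subg k : capp k - gapp k =
  pad (pad (fun j => q ^+ j ^+ 2 * q ^+ 2 * capp j)) k.
Proof.
rewrite /capp /gapp.
have -> : pair_sum capp_term k =
    pair_sum (fun m n => (1 - q ^+ m) * capp_term m n) k
    + pair_sum (fun m n => q ^+ m * capp_term m n) k.
  by rewrite -pair_sumD; apply: eq_pair_sum => m n; ring.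
rewrite addrK pair_sum_padl => [|n]; last by rewrite expr0 subrr mul0r.
case: k => [|[|k]] //=.
rewrite -(pair_sum_weight (fun j => q ^+ j ^+ 2 * q ^+ 2)).
by apply: eq_pair_sum => m n; rewrite capp_termSl.
Qed.

(** On the terms with [2m + 3n = k], [1 - q^k = (1 - q^(2m)) + q^(2m) (1 - q^(3n))]; the first part
    lowers [m], the second lowers [n]. *)
Let capp_rec4 k : capp k - q ^+ k * capp k =
  pad (pad (fun j => q ^+ j ^+ 2 * q ^+ 2 * (capp j + q * gapp j))) k
  + pad (pad (pad (fun j => q ^+ j ^+ 4 * q ^+ 6 * capp j))) k.
Proof.
rewrite /capp /gapp -(pair_sum_weight (fun j => q ^+ j)).
have -> : pair_sum capp_term k =
    pair_sum (fun m n => (1 - q ^+ m ^+ 2) * capp_term m n) k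
    + pair_sum (fun m n => q ^+ m ^+ 2 * (1 - q ^+ 3 ^+ n) * capp_term m n) k
    + pair_sum (fun m n => q ^+ (2 * m + 3 * n) * capp_term m n) k.
  rewrite -!pair_sumD; apply: eq_pair_sum => m n.
  by rewrite exprD mulnC !exprM; ring.
rewrite addrK; congr (_ + _).
  rewrite pair_sum_padl => [|n]; last by rewrite !expr0 expr1n subrr mul0r.
  case: k => [|[|k]] //=.
  have -> : pair_sum (fun m n => (1 - q ^+ m.+1 ^+ 2) * capp_term m.+1 n) k =
    pair_sum (fun m n => (q ^+ (2 * m + 3 * n) ^+ 2 * q ^+ 2)
      * (capp_term m n + q * (q ^+ m * capp_term m n))) k.
    apply: eq_pair_sum => m n.
    rewrite (_ : 1 - _ = (1 + q ^+ m.+1) * (1 - q ^+ m.+1)); last by ring.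
    by rewrite -(mulrA (1 + q ^+ m.+1)) capp_termSl exprS; ring.
  rewrite (pair_sum_weight (fun j => q ^+ j ^+ 2 * q ^+ 2)) pair_sumD.
  by rewrite (pair_sum_weight (fun j => q)).
rewrite pair_sum_padr => [|m]; last by rewrite !expr0 subrr mulr0 mul0r.
case: k => [|[|[|k]]] //=.
rewrite -(pair_sum_weight (fun j => q ^+ j ^+ 4 * q ^+ 6)).
by apply: eq_pair_sum => m n; rewrite capp_termSr.
Qed.

Let defect k := capp k - (q ^+ k * capp k
  + q * pad (fun j => q ^+ j * capp j) k
  - q * pad (fun j => q ^+ j ^+ 2 * capp j) k
  + q ^+ 2 * pad (pad (fun j => q ^+ j ^+ 2 * capp j)) k
  + q ^+ 3 * pad (pad (fun j => q ^+ j ^+ 3 * capp j)) k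
  - q ^+ 5 * pad (pad (pad (fun j => q ^+ j ^+ 3 * capp j))) k).

Let gappE k : gapp k = capp k - pad (pad (fun j => q ^+ j ^+ 2 * q ^+ 2 * capp j)) k.
Proof. by rewrite -capp_subg; ring. Qed.

(* The order-four recurrence [capp_rec4] factors through the order-three one. *)
Let defectS k : defect k.+1 = - (q ^+ k.+1 * defect k).
Proof.
apply/eqP; rewrite -subr_eq0; apply/eqP.
have := capp_rec4 k.+1 => /eqP; rewrite -subr_eq0 => /eqP <-; rewrite /defect.
case: k => [|[|[|k]]] /=; rewrite ?gappE /= ?exprS; ring.
Qed.

Lemma capp_rec3 k : capp k = q ^+ k * capp k
  + q * pad (fun j => q ^+ j * capp j) k
  - q * pad (fun j => q ^+ j ^+ 2 * capp j) k
  + q ^+ 2 * pad (pad (fun j => q ^+ j ^+ 2 * capp j)) k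
  + q ^+ 3 * pad (pad (fun j => q ^+ j ^+ 3 * capp j)) k
  - q ^+ 5 * pad (pad (pad (fun j => q ^+ j ^+ 3 * capp j))) k.
Proof.
apply/eqP; rewrite -subr_eq0; apply/eqP; change (defect k = 0).
elim: k => [|k IH]; last by rewrite defectS IH mulr0 oppr0.
by rewrite /defect /= expr0; ring.
Qed.

(** Shifts of these sequences are the common basis in which all terms of [capp_conv_rec] get
    expanded. *)
Let A (i : nat) := conv (fun k => q ^+ k ^+ i * capp k) (fun k => e k%:Z).

Definition capp_conv := conv capp (fun k => e k%:Z).

(** Write [q^k = q^j q^(k-j)]: the first factor raises the weight on [capp], and
    [q^n e_n = e_n - e_(n-1)] turns the second into a difference. *)
Let A_weight i k : q ^+ k * A i k = A i.+1 k - pad (A i.+1) k.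
Proof.
rewrite /A -conv_padr /conv mulr_sumr -sumrB; apply: eq_bigr => j _.
have {1}-> : k = (j + (k - j))%N by have := ltn_ord j; lia.
have -> : pad (fun i => e i%:Z) (k - j)%N =
    (1 - q ^+ (k - j)) * e (k - j)%N%:Z.
  case: (k - j)%N => [|n] /=; last by rewrite inv_qpochS.
  by rewrite expr0 subrr mul0r.
by rewrite exprD (exprS _ i); ring.
Qed.

Let conv_rec k : capp_conv k = A 1 k + q * pad (A 1) k - q * pad (A 2) k
  + q ^+ 2 * pad (pad (A 2)) k + q ^+ 3 * pad (pad (A 3)) k
  - q ^+ 5 * pad (pad (pad (A 3))) k.
Proof.
rewrite /capp_conv /A.
have -> : conv capp (fun k => e k%:Z) k = conv (fun k => q ^+ k ^+ 1 * capp k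
  + q * pad (fun j => q ^+ j ^+ 1 * capp j) k
  + - q * pad (fun j => q ^+ j ^+ 2 * capp j) k
  + q ^+ 2 * pad (pad (fun j => q ^+ j ^+ 2 * capp j)) k
  + q ^+ 3 * pad (pad (fun j => q ^+ j ^+ 3 * capp j)) k
  + - q ^+ 5 * pad (pad (pad (fun j => q ^+ j ^+ 3 * capp j))) k)
  (fun k => e k%:Z) k.
  by apply: eq_bigr => j _; rewrite {1}capp_rec3 !mulNr.
rewrite !conv_lin !mulNr.
have cp u j : conv (pad u) (fun k => e k%:Z) j = pad (conv u (fun k => e k%:Z)) j.
  exact: conv_padl.
have cp2 u j : conv (pad (pad u)) (fun k => e k%:Z) j
   = pad (pad (conv u (fun k => e k%:Z))) j.
  by rewrite cp; case: j => //= j; rewrite cp.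
have cp3 u j : conv (pad (pad (pad u))) (fun k => e k%:Z) j
   = pad (pad (pad (conv u (fun k => e k%:Z)))) j.
  by rewrite cp; case: j => //= j; rewrite cp2.
by rewrite !cp3 !cp2 !cp.
Qed.

Let conv_w1 k : q ^+ k * capp_conv k = A 1 k - pad (A 1) k.
Proof.
rewrite -A_weight; congr (_ * _); apply: eq_bigr => j _.
by rewrite expr0 mul1r.
Qed.

Let conv_w2 k : q ^+ k ^+ 2 * capp_conv k =
  A 2 k - (1 + q) * pad (A 2) k + q * pad (pad (A 2)) k.
Proof.
rewrite exprS expr1 -mulrA conv_w1 mulrBr A_weight.
case: k => [|k] /=; first by ring.
by rewrite (exprS q k) -(mulrA q) A_weight; ring.
Qed.

Let conv_w3 k : q ^+ k ^+ 3 * capp_conv k =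
  A 3 k - (1 + q + q ^+ 2) * pad (A 3) k
  + (q + q ^+ 2 + q ^+ 3) * pad (pad (A 3)) k - q ^+ 3 * pad (pad (pad (A 3))) k.
Proof.
rewrite exprS -mulrA conv_w2.
have -> : q ^+ k * (A 2 k - (1 + q) * pad (A 2) k + q * pad (pad (A 2)) k) =
    q ^+ k * A 2 k - (1 + q) * q * pad (fun j => q ^+ j * A 2 j) k
    + q ^+ 3 * pad (pad (fun j => q ^+ j * A 2 j)) k.
  by case: k => [|[|k]] /=; rewrite ?(exprS q); ring.
by case: k => [|[|k]] /=; rewrite !A_weight /=; ring.
Qed.

Lemma capp_conv0 : capp_conv 0 = 1.
Proof.
rewrite /capp_conv /conv big_ord_recl big_ord0 /capp /pair_sum.
rewrite big_ord_recl big_ord0 big_mkcond big_ord_recl big_ord0 /= /capp_term.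
by rewrite /inv_qpoch !qpoch0 !invr1 !addr0 expr0 !mulr1.
Qed.

Lemma capp_conv1 : (1 - q) * capp_conv 1 = 1.
Proof.
have := conv_w1 1; have := conv_rec 1; have := conv_w1 0; have := conv_w2 0.
rewrite /= expr0 expr1 expr1n !mul1r !(mulr0, addr0, subr0) => h2 h1 h0 h.
rewrite mulrBl mul1r h h0 -h1 -h2 -[RHS]capp_conv0; ring.
Qed.

(** Every term is [capp_conv] times a power of [q^k] with exponent at most 3, hence a combination of
    shifts of [A 1], [A 2] and [A 3]; in these the claim is a linear identity. *)
Lemma capp_conv_rec k :
  (1 - q ^+ k.+2) * capp_conv k.+2 =
  (1 + q - q * (q ^+ k.+1) ^+ 2) * capp_conv k.+1
  - q * (1 + q ^+ k.+1) * (1 - q * q ^+ k ^+ 2) * capp_conv k.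
Proof.
have -> : (1 - q ^+ k.+2) * capp_conv k.+2 = capp_conv k.+2 - q ^+ k.+2 * capp_conv k.+2.
  by ring.
have -> : (1 + q - q * (q ^+ k.+1) ^+ 2) * capp_conv k.+1 =
   (1 + q) * capp_conv k.+1 - q * (q ^+ k.+1 ^+ 2 * capp_conv k.+1) by ring.
have -> : q * (1 + q ^+ k.+1) * (1 - q * q ^+ k ^+ 2) * capp_conv k =
  q * capp_conv k + q ^+ 2 * (q ^+ k * capp_conv k)
  - q ^+ 2 * (q ^+ k ^+ 2 * capp_conv k) - q ^+ 3 * (q ^+ k ^+ 3 * capp_conv k).
  by rewrite exprS; ring.
rewrite !conv_w3 !conv_w2 !conv_w1 !conv_rec.
by case: k => [|[|[|k]]] /=; ring.
Qed.

End CapparelliSums.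

(** * The Bailey chain *)

Section BaileyChain.
Context (K : numFieldType) (q : K) (c : int -> K) (N : nat).
Hypothesis q_neq1 : forall k, 1 - q ^+ k.+1 != 0.
Hypothesis c_rec : forall j, c (j + 1) + c j + c (j - 1) = 0.
Hypothesis c0 : c 0 = 1.
Local Notation e := (inv_qpoch q).

(** The Bailey pair. Once [(q)_(2L)] and [(q)_L] are absorbed, using [1 - q^(2L+2) = (1 - q^(L+1))
    (1 + q^(L+1))], both sides obey one three-term recurrence, and they agree at 0 and 1. *)
Lemma theta_poly_capp L : (L < N)%N ->
  qpoch q q (2 * L) * theta_poly q c N L = qpoch q q L * capp_conv q L.
Proof.
pose P L := (L < N)%N ->
  qpoch q q (2 * L) * theta_poly q c N L = qpoch q q L * capp_conv q L.
have [h0 h1 hS] : [/\ P 0%N, P 1%N & forall L, P L -> P L.+1 -> P L.+2].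
  split.
  - by move=> _; rewrite theta_poly0 c0 capp_conv0 // qpoch0.
  - move=> N1; have N0 := ltnW N1.
    rewrite !qpochS !qpoch0 !mul1r -!exprS expr1 theta_poly1 // c0.
    by rewrite capp_conv1.
  move=> {}L IH0 IH1 lt2; have lt1 := ltnW lt2; have lt0 := ltnW lt1.
  have {}IH0 := IH0 lt0; have {}IH1 := IH1 lt1.
  have Pn2 : qpoch q q (2 * L.+2) =
      qpoch q q (2 * L.+1) * ((1 - q ^+ (2 * L).+3) * (1 - q ^+ (2 * L).+4)).
    by rewrite mulnS add2n !qpochS -!exprS mulnS add2n mulrA.
  have Pn1 : qpoch q q (2 * L.+1) =
      qpoch q q (2 * L) * ((1 - q * q ^+ L ^+ 2) * (1 - q ^+ L.+1 ^+ 2)).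
    have -> : q * q ^+ L ^+ 2 = q ^+ (2 * L).+1.
      by rewrite -exprM -exprS; congr (q ^+ _); lia.
    have -> : q ^+ L.+1 ^+ 2 = q ^+ (2 * L).+2.
      by rewrite -exprM; congr (q ^+ _); lia.
    by rewrite mulnS add2n !qpochS -!exprS -!mulrA.
  rewrite Pn2 -mulrA theta_poly_rec // mulrBr mulrCA IH1.
  rewrite (qpochS _ _ L.+1) -exprS -mulrA capp_conv_rec //.
  rewrite [in X in _ - X = _]Pn1.
  have -> : qpoch q q (2 * L) * ((1 - q * q ^+ L ^+ 2) * (1 - q ^+ L.+1 ^+ 2))
      * (q * theta_poly q c N L)
    = (1 - q * q ^+ L ^+ 2) * (1 - q ^+ L.+1 ^+ 2) * q
      * (qpoch q q (2 * L) * theta_poly q c N L).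
    by ring.
  rewrite IH0 qpochS -exprS.
  have -> : q ^+ (2 * L).+3 = q * q ^+ L.+1 ^+ 2.
    by rewrite -exprM -exprS; congr (q ^+ _); lia.
  ring.
suff [] : P L /\ P L.+1 by [].
by elim: L => [|L [IH0 IH1]]; split=> //; exact: hS.
Qed.

Lemma capp_conv_box (L B : nat) : (L < B)%N ->
  \sum_(m < B) \sum_(n < B) capp_term q m n * e (L%:Z - 3 * n%:Z - 2 * m%:Z)
  = capp_conv q L.
Proof.
move=> ltLB; rewrite /capp_conv /conv.
have E (k : 'I_L.+1) : capp q k * e (L - k)%N%:Z =
   \sum_(m < B) \sum_(n < B)
     (if (2 * m + 3 * n == k)%N then capp_term q m n * e (L - k)%N%:Z else 0).
  have ltkB : (k < B)%N by have := ltn_ord k; lia.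
  rewrite /capp (pair_sum_widen _ ltkB ltkB) mulr_suml; apply: eq_bigr => m _.
  by rewrite mulr_suml big_mkcond.
rewrite (eq_bigr _ (fun k _ => E k)) [RHS]exchange_big /=; apply: eq_bigr => m _.
rewrite [RHS]exchange_big /=; apply: eq_bigr => n _.
have [leL|ltL] := leqP (2 * m + 3 * n) L.
  have lt1 : (2 * m + 3 * n < L.+1)%N by [].
  rewrite (bigD1 (Ordinal lt1)) //= eqxx big1 ?addr0 => [|k nk].
    by congr (_ * e _); lia.
  by case: eqP => // h; move: nk; rewrite -val_eqE /= h eqxx.
rewrite inv_qpoch_lt0 ?mulr0; last by lia.
by rewrite big1 // => k _; case: eqP => // h; have := ltn_ord k; lia.
Qed.

Definition theta_level (k L : nat) : K :=
  zsum N (fun j => c j * (q ^+ (k * `|j| ^ 2) * (e (L%:Z - j) * e (L%:Z + j)))).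

Lemma theta_level1 L : theta_level 1 L = theta_poly q c N L.
Proof. by apply: eq_zsum => j; rewrite mul1n. Qed.

Lemma bailey_step k L :
  \sum_(r < L.+1) e (L%:Z - r%:Z) * q ^+ (r ^ 2) * theta_level k r
  = theta_level k.+1 L.
Proof.
rewrite /theta_level /zsum.
under eq_bigr => r _ do rewrite mulr_sumr.
rewrite exchange_big /=; apply: eq_bigr => i _; set j := (i%:Z - N%:Z).
rewrite mulSn exprD [q ^+ (`|j| ^ 2) * _]mulrC -[X in _ = _ * X]mulrA -bailey_lemma //.
rewrite !mulr_sumr; apply: eq_bigr => r _.
have -> : L%:Z - r%:Z = (L - r)%N by have := ltn_ord r; lia.
by ring.
Qed.

(** At each stage [sumn s] is the tail sum [N_i]. The last index carries [b] instead of [1/(q)_n],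
    whence the separate case of a singleton. *)
Fixpoint chain (b : nat -> K) (s : seq nat) : K :=
  match s with
  | [::] => 1
  | n :: s' => if s' is [::] then q ^+ (n ^ 2) * b n
               else q ^+ (sumn s ^ 2) * e n%:Z * chain b s'
  end.

Fixpoint box (f B : nat) : seq (seq nat) :=
  if f is f'.+1 then [seq n :: s | n <- index_iota 0 B, s <- box f' B]
  else [:: [::]].

Lemma boxS f B :
  box f.+1 B = [seq n :: s | n <- index_iota 0 B, s <- box f B].
Proof. by []. Qed.

Lemma mem_box f B s : (s \in box f B) = (size s == f) && all (fun n => n < B)%N s.
Proof.
elim: f s => [|f IH] s /=; first by rewrite inE -size_eq0; case: s.
apply/allpairsP/idP => [[[n t] /= [hn ht ->]]|].
  by move: hn ht; rewrite mem_index_iota IH /= eqSS => -> /andP[-> ->].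
case: s => // n s; rewrite /= eqSS andbCA => /andP[hn hs].
by exists (n, s); split; rewrite ?mem_index_iota ?IH.
Qed.

Lemma box_uniq f B : uniq (box f B).
Proof.
elim: f => [|f IH] //=; apply: allpairs_uniq => //; first exact: iota_uniq.
by move=> [n s] [n' s'] _ _ /= [-> ->].
Qed.

(** Substitute [r = n + s]; the range is cut above by the vanishing of [H] and below by that of
    [inv_qpoch]. *)
Lemma sum_shift_inv (L B s : nat) (H : nat -> K) : (L < B)%N ->
  (forall r, (L < r)%N -> H r = 0) ->
  \sum_(0 <= n < B) H (n + s)%N * e n%:Z = \sum_(r < L.+1) H r * e (r%:Z - s%:Z).
Proof.
move=> ltLB H0.
have [ltLs|lesL] := ltnP L s.
  rewrite big1 => [|n _]; last by rewrite H0 ?mul0r //; lia.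
  rewrite big1 // => r _; rewrite inv_qpoch_lt0 ?mulr0 //.
  by have := ltn_ord r; lia.
rewrite (big_cat_nat (n := L.+1 - s)) //=; last by lia.
rewrite [X in _ + X]big_nat_cond [X in _ + X]big1 ?addr0; last first.
  by move=> n; rewrite andbT => hn; rewrite H0 ?mul0r //; lia.
rewrite -(big_mkord xpredT (fun r => H r * e (r%:Z - s%:Z))).
rewrite [RHS](big_cat_nat (n := s)) //=; last by lia.
rewrite [X in _ = X + _]big_nat_cond [X in _ = X + _]big1 ?add0r; last first.
  by move=> r; rewrite andbT => hr; rewrite inv_qpoch_lt0 ?mulr0 //; lia.
rewrite [RHS](_ : _ = \sum_(0 + s <= r < L.+1) H r * e (r%:Z - s%:Z)) //.
rewrite big_addn; apply: eq_bigr => i _.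
by congr (_ * e _); lia.
Qed.

(** With [r = N_1], the sum over the first index is one Bailey step applied to the remaining chain
    truncated at level [r]. The hypothesis on [b] stops at [L] because [b] will itself be a double
    sum truncated at [L]. *)
Lemma chain_sum (b : nat -> K) (f L B : nat) : (L < B)%N ->
  (forall r, (r <= L)%N -> b r = theta_level 1 r) ->
  \sum_(s <- box f.+1 B) e (L%:Z - (sumn s)%:Z) * chain b s = theta_level f.+2 L.
Proof.
elim: f L => [|f IH] L ltLB hb.
  rewrite -bailey_step boxS big_allpairs_dep /=.
  under eq_bigr => n _ do rewrite big_seq1 /= addn0.
  rewrite (big_cat_nat (n := L.+1)) //= [X in _ + X]big_nat_cond [X in _ + X]big1 ?addr0.
    by rewrite big_mkord; apply: eq_bigr => r _; rewrite mulrA hb // -ltnS.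
  by move=> n; rewrite andbT => hn; rewrite inv_qpoch_lt0 ?mul0r //; lia.
rewrite -bailey_step boxS big_allpairs_dep /= exchange_big /=.
have E s : s \in box f.+1 B ->
    \sum_(0 <= n < B) e (L%:Z - (sumn (n :: s))%:Z) * chain b (n :: s) =
    \sum_(r < L.+1) e (L%:Z - r%:Z) * q ^+ (r ^ 2) * (e (r%:Z - (sumn s)%:Z) * chain b s).
  rewrite mem_box; case: s => // x s _.
  under [RHS]eq_bigr => r _ do rewrite mulrA.
  rewrite -[RHS]mulr_suml -(@sum_shift_inv L B _ (fun r => e (L%:Z - r%:Z) * q ^+ (r ^ 2))) //.
    rewrite mulr_suml; apply: eq_bigr => n _.
    by rewrite [chain b (n :: _)]/= -/(chain b (x :: s)) [sumn (n :: _)]/=; ring.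
  by move=> r ltr; rewrite inv_qpoch_lt0 ?mul0r //; lia.
rewrite big_seq (eq_bigr _ E) -big_seq exchange_big /=; apply: eq_bigr => r _.
have ltr := ltn_ord r.
rewrite -mulr_sumr IH //; first by lia.
by move=> i hi; apply: hb; lia.
Qed.

Lemma chain_factor b s : s != [::] -> chain b s = chain (fun=> 1) s * b (last 0%N s).
Proof.
elim: s => //= n [|m s] IH _; first by rewrite mulr1.
by rewrite IH // !mulrA.
Qed.

End BaileyChain.

(** * Unordered sums *)

(** The analysis takes place over an abstract [numFieldType], whose norm has values in the field
    itself. This property and [cauchy_complete] are what it assumes of the field. *)
Definition archimedean_field (K : numFieldType) : Prop :=
  forall x : K, 0 <= x -> exists n : nat, x <= n%:R.

(** Arbitrary proper filters cover both sequences and the net of finite subsets. *)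
Definition cauchy_complete (K : numFieldType) : Prop :=
  forall (I : Type) (F : set_system I) (u : I -> K), ProperFilter F ->
  (forall e, 0 < e -> exists2 A, F A & forall i j, A i -> A j -> `|u i - u j| <= e) ->
  cvg (u @ F).

Definition abs_bounded (K : numFieldType) (I : choiceType) (F : I -> K) (M : K) :=
  forall A : {fset I}, \sum_(i <- A) `|F i| <= M.

Section UnorderedSums.
Context (K : numFieldType) (I : choiceType).
Hypothesis K_archi : archimedean_field K.
Hypothesis K_complete : cauchy_complete K.
Implicit Types (F : I -> K) (A B : {fset I}).

Lemma partial_sumE F A : summability.partial_sum F A = \sum_(i <- A) F i.
Proof. by rewrite /summability.partial_sum big_seq_fsetE. Qed.

Lemma sum_fsetD (F : I -> K) A B : (A `<=` B)%fset ->
  \sum_(i <- B) F i = \sum_(i <- A) F i + \sum_(i <- (B `\` A)%fset) F i.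
Proof.
move=> /fsubsetP sAB; rewrite (big_fsetID _ (mem A)) /=; congr (_ + _).
  congr (\sum_(i <- enum_fset _) _); apply/fsetP => x; rewrite !inE /=.
  by case: (boolP (x \in A)) => [/sAB->|]; rewrite ?andbF.
by congr (\sum_(i <- enum_fset _) _); apply/fsetP => x; rewrite !inE /= andbC.
Qed.

Lemma fdisjoint_fsetDr A B : [disjoint A & B `\` A]%fset.
Proof. by apply/fdisjointP => x xA; rewrite inE xA. Qed.

(** Otherwise disjoint finite sets of mass above [e] could be adjoined forever, and by the
    Archimedean property their total would exceed [M]. *)
Lemma abs_bounded_tail F M : abs_bounded F M -> forall e, 0 < e ->
  exists A, forall B, [disjoint A & B]%fset -> \sum_(i <- B) `|F i| <= e.
Proof.
move=> FM e e0; apply: contrapT => /forallNP noA.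
have big n : exists A : {fset I}, n%:R * e <= \sum_(i <- A) `|F i|.
  elim: n => [|n [A leA]]; first by exists fset0; rewrite mul0r big_seq_fset0.
  have /existsNP[B /not_implyP[dAB nle]] := noA A.
  exists (A `|` B)%fset; rewrite (sum_fsetD _ (fsubsetUl A B)).
  have -> : ((A `|` B) `\` A = B)%fset.
    rewrite fsetDUl fsetDv fset0U; apply/fsetDidPl; by rewrite fdisjoint_sym.
  rewrite -natr1 mulrDl mul1r lerD //; apply/ltW.
  (* The order is only partial: the negated inequality can be reversed because both sides are
     real. *)
  rewrite real_ltNge; first exact/negP.
    exact: gtr0_real.
  by apply: sum_real => i _; apply: normr_real.
have M0 : 0 <= M by apply: le_trans (FM fset0); rewrite big_seq_fset0.
have [n len] : exists n : nat, M / e <= n%:R.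
  by apply: K_archi; rewrite divr_ge0 // ltW.
have [A leA] := big n.+1.
suff : M < n.+1%:R * e by move/lt_le_trans => /(_ _ (le_trans leA (FM A))); rewrite ltxx.
by rewrite -ltr_pdivrMr //; apply: le_lt_trans len _; rewrite ltr_nat.
Qed.

Lemma abs_bounded_has_usum F M : abs_bounded F M -> has_usum F.
Proof.
move=> FM; apply: K_complete => [|e e0]; first exact: summability.totally_filter.
have [A0 hA0] := abs_bounded_tail FM (divr_gt0 e0 (ltr0n K 2)).
exists [set B | (A0 `<=` B)%fset]; first by exists A0.
move=> B C /= sB sC; rewrite !partial_sumE (sum_fsetD F sB) (sum_fsetD F sC).
rewrite opprD addrACA subrr add0r [e]splitr.
apply: le_trans (ler_normB _ _) _; apply: lerD;
  by apply: le_trans (ler_norm_sum _ _ _) (hA0 _ _); apply: fdisjoint_fsetDr.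
Qed.

Lemma usum_approx F M : abs_bounded F M -> forall e, 0 < e -> exists A0 : {fset I},
  (forall B, [disjoint A0 & B]%fset -> \sum_(i <- B) `|F i| <= e) /\
  (forall B, (A0 `<=` B)%fset -> `|usum F - \sum_(i <- B) F i| <= e).
Proof.
move=> FM e e0; have [A1 hA1] := abs_bounded_tail FM e0.
have cvF : (summability.partial_sum F @ summability.totally --> usum F).
  exact: (abs_bounded_has_usum FM).
have FT := @summability.totally_filter I.
have /cvgrPdist_le /(_ _ e0) [A2 _ hA2] := cvF.
exists (A1 `|` A2)%fset; split=> B.
  by move=> dB; apply: hA1; move: dB; rewrite fdisjointUX => /andP[].
by rewrite fsubUset => /andP[_ s2]; rewrite -partial_sumE; exact: hA2.
Qed.

Lemma near_all (s : seq I) (P : I -> nat -> Prop) :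
  (forall x, \forall n \near \oo, P x n) ->
  \forall n \near \oo, forall x, x \in s -> P x n.
Proof.
move=> hP; elim: s => [|y s IH]; first by near=> n.
near=> n => x; rewrite inE => /orP[/eqP->|xs]; first by near: n; exact: hP.
by move: x xs; near: n.
Unshelve. all: by end_near. Qed.

(** Dominated convergence: off a finite set [A0] the family has small mass, and on [A0] finitely
    many weights are eventually close to [w0]. *)
Lemma tannery F M (A : nat -> {fset I}) (w : nat -> I -> K) (w0 C : K) :
  abs_bounded F M -> 0 <= C ->
  (forall x, \forall n \near \oo, x \in A n) ->
  (forall x, w n x @[n --> \oo] --> w0) ->
  (forall n x, `|w n x| <= C) ->
  (\sum_(x <- A n) F x * w n x) @[n --> \oo] --> usum F * w0.
Proof.
move=> FM C0 hA hw hC.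
have M0 : 0 <= M by apply: le_trans (FM fset0); rewrite big_seq_fset0.
apply/cvgrPdistC_le => e e0.
(* [D] collects the errors below: [M] from the weights on [A0], [C + |w0|] from the tail, [|w0|]
   from the truncation of the sum. The 1 keeps it positive. *)
pose D := 1 + (M + (C + `|w0|) + `|w0|).
have D0 : 0 < D by rewrite /D ltr_pwDl // !addr_ge0.
have e1 : 0 < e / D by rewrite divr_gt0.
have [A0 [tailA0 apprA0]] := usum_approx FM e1.
have hA0 := near_all (enum_fset A0) hA.
have hw' x : \forall n \near \oo, `|w n x - w0| <= e / D.
  by have /cvgrPdistC_le /(_ _ e1) := hw x.
have hw0 := near_all (enum_fset A0) hw'.
near=> n.
have sA : (A0 `<=` A n)%fset by apply/fsubsetP; near: n.
have wA : forall x, x \in A0 -> `|w n x - w0| <= e / D by near: n.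
have -> : \sum_(x <- A n) F x * w n x - usum F * w0 =
   \sum_(x <- A0) F x * (w n x - w0)
   + \sum_(x <- (A n `\` A0)%fset) F x * (w n x - w0)
   - (usum F - \sum_(x <- A n) F x) * w0.
  rewrite -(sum_fsetD (fun x => F x * (w n x - w0)) sA) mulrBl opprB addrA.
  congr (_ - _); rewrite mulr_suml -big_split /=.
  by apply: eq_bigr => x _; ring.
have -> : e = e / D + (M * (e / D) + (e / D) * (C + `|w0|) + (e / D) * `|w0|).
  by rewrite -{1}(divfK (lt0r_neq0 D0) e) {2}/D; ring.
apply: ler_wpDl; first exact: ltW.
apply: le_trans (ler_normB _ _) _; apply: lerD; last first.
  by rewrite normrM ler_wpM2r // apprA0.
apply: le_trans (ler_normD _ _) _; apply: lerD.
  apply: le_trans (ler_norm_sum _ _ _) _.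
  apply: (@le_trans _ _ (\sum_(x <- A0) `|F x| * (e / D))).
    rewrite big_seq [leRHS]big_seq; apply: ler_sum => x xA.
    by rewrite normrM ler_wpM2l // wA.
  by rewrite -mulr_suml ler_wpM2r // ltW.
apply: le_trans (ler_norm_sum _ _ _) _.
apply: (@le_trans _ _ (\sum_(x <- (A n `\` A0)%fset) `|F x| * (C + `|w0|))).
  apply: ler_sum => x _; rewrite normrM ler_wpM2l //.
  by apply: le_trans (ler_normB _ _) _; rewrite lerD2r.
rewrite -mulr_suml ler_wpM2r ?addr_ge0 //; apply: tailA0; exact: fdisjoint_fsetDr.
Unshelve. all: by end_near. Qed.

End UnorderedSums.

(** * Infinite products *)

Section InfiniteProducts.
Context (K : numFieldType).
Hypothesis K_archi : archimedean_field K.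
Hypothesis K_complete : cauchy_complete K.
Implicit Types (a p : K) (r : K).

(** Bernoulli's inequality for [1/r = 1 + d], followed by the Archimedean property. *)
Lemma expr_small r e : 0 <= r -> r < 1 -> 0 < e -> exists n, r ^+ n <= e.
Proof.
move=> r0 r1 e0; have [->|rn0] := eqVneq r 0.
  by exists 1%N; rewrite expr1 ltW.
have rgt0 : 0 < r by rewrite lt0r rn0.
pose d := r^-1 - 1.
have d0 : 0 < d by rewrite subr_gt0 invf_gt1.
have bern n : n%:R * d <= r^-1 ^+ n.
  suff : 1 + n%:R * d <= r^-1 ^+ n by apply: le_trans; rewrite lerDr.
  elim: n => [|n IH]; first by rewrite mul0r addr0 expr0.
  have rV : r^-1 = 1 + d by rewrite /d addrC subrK.
  rewrite exprS {1}rV; apply: le_trans (ler_wpM2l _ IH); last first.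
    by rewrite addr_ge0 // ltW.
  have -> : (1 + d) * (1 + n%:R * d) = 1 + n.+1%:R * d + n%:R * d ^+ 2.
    by rewrite -natr1; ring.
  by rewrite lerDl mulr_ge0 // exprn_ge0 // ltW.
have [n len] : exists n : nat, (e * d)^-1 <= n%:R.
  by apply: K_archi; rewrite invr_ge0 mulr_ge0 // ltW.
exists n; rewrite -[r]invrK exprVn invf_ple ?posrE ?exprn_gt0 ?invr_gt0 //.
apply: le_trans (bern n); rewrite -ler_pdivrMr //.
by rewrite -invfM.
Qed.

(** No exponential is involved: with [a = C/(1-r)], as soon as [a r^k0 <= 1/2] the inequality
    [P_n <= 2 P_k0 (1 - a r^n)] holds at [k0] and persists. *)
Lemma prod_geometric_bounded r C : 0 <= r -> r < 1 -> 0 <= C ->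
  exists2 M : K, 0 <= M & forall n, \prod_(k < n) (1 + C * r ^+ k) <= M.
Proof.
move=> r0 r1 C0; pose P n := \prod_(k < n) (1 + C * r ^+ k).
have t0 k : 0 <= C * r ^+ k by rewrite mulr_ge0 // exprn_ge0.
have P0 n : 0 <= P n by apply: prodr_ge0 => k _; rewrite addr_ge0.
have PS n : P n.+1 = P n * (1 + C * r ^+ n) by rewrite /P big_ord_recr.
have Pmono n d : P n <= P (n + d)%N.
  elim: d => [|d IH]; rewrite ?addn0 // addnS PS; apply: le_trans IH _.
  by rewrite ler_peMr // lerDl.
pose a := C / (1 - r).
have r1' : 0 < 1 - r by rewrite subr_gt0.
have a0 : 0 <= a by rewrite divr_ge0 // ltW.
have Ca : C = a * (1 - r) by rewrite /a divfK // lt0r_neq0.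
clearbody a.
have [k0 hk0] : exists n, r ^+ n <= (2 * (1 + a))^-1.
  by apply: expr_small => //; rewrite invr_gt0 mulr_gt0 // ltr_pwDl.
have ark0 : a * r ^+ k0 <= 2^-1.
  apply: le_trans (ler_wpM2l a0 hk0) _.
  rewrite invfM mulrCA ler_piMr ?invr_ge0 // ler_pdivrMr ?ltr_pwDl // mul1r.
  by rewrite lerDr.
(* The bound is preserved because (1 - a x)(1 + C x) <= 1 - a r x for a = C/(1-r). *)
have inv d : P (k0 + d)%N <= 2 * P k0 * (1 - a * r ^+ (k0 + d)).
  elim: d => [|d IH].
    have -> : 2 * P k0 * (1 - a * r ^+ (k0 + 0)) = P k0 * (2 - 2 * (a * r ^+ k0)).
      by rewrite addn0; ring.
    rewrite addn0 -[leLHS]mulr1 ler_wpM2l // lerBrDr -[leRHS]/(1 + 1) lerD2l.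
    by rewrite -[leRHS](mulfV (lt0r_neq0 (ltr0n K 2))) ler_wpM2l.
  rewrite addnS PS; set x := r ^+ (k0 + d).
  have x0 : 0 <= x by rewrite exprn_ge0.
  have h1 : 0 <= 1 + C * x by rewrite addr_ge0 // mulr_ge0.
  apply: le_trans (ler_wpM2r h1 IH) _.
  rewrite -(mulrA (2 * P k0)) ler_wpM2l ?mulr_ge0 // exprS -/x.
  have -> : (1 - a * x) * (1 + C * x) = 1 - a * (r * x) - a * C * x ^+ 2.
    by rewrite Ca; ring.
  by rewrite lerBlDr lerDl !mulr_ge0.
exists (2 * P k0) => [|n]; first by rewrite mulr_ge0.
apply: le_trans (Pmono n k0) _; rewrite addnC; apply: le_trans (inv n) _.
by rewrite ler_piMr ?mulr_ge0 // lerBlDr lerDl mulr_ge0 // exprn_ge0.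
Qed.

Lemma qpoch_bounded a p : `|p| < 1 ->
  exists2 M : K, 0 <= M & forall n, `|qpoch a p n| <= M.
Proof.
move=> p1; have [M M0 hM] := prod_geometric_bounded (normr_ge0 p) p1 (normr_ge0 a).
exists M => // n; apply: le_trans (hM n); rewrite normr_prod.
apply: ler_prod => k _; rewrite normr_ge0 /=.
by apply: le_trans (ler_normB _ _) _; rewrite normr1 normrM normrX.
Qed.

Lemma one_subX_neq0 p k : `|p| < 1 -> 1 - p ^+ k.+1 != 0.
Proof.
move=> p1; rewrite subr_eq0; apply/eqP => h.
have : `|p| ^+ k.+1 < 1 by rewrite exprn_ilt1.
by rewrite -normrX -h normr1 ltxx.
Qed.

(** For [r = |p|], [1/(1 - r^(k+1)) = 1 + r^(k+1)/(1 - r^(k+1)) <= 1 + (r/(1-r)) r^k], so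
    [prod_geometric_bounded] applies. *)
Lemma inv_qpoch_bounded p : `|p| < 1 ->
  exists2 M : K, 0 <= M & forall k, `|inv_qpoch p k| <= M.
Proof.
move=> p1; set r := `|p|; have r0 : 0 <= r by exact: normr_ge0.
have r1' : 0 < 1 - r by rewrite subr_gt0.
have C0 : 0 <= r / (1 - r) by rewrite divr_ge0 // ltW.
have [M M0 hM] := prod_geometric_bounded r0 p1 C0.
exists M => //; case=> [n|n] /=; last by rewrite normr0.
apply: le_trans (hM n); rewrite normfV normr_prod -prodfV.
apply: ler_prod => k _; rewrite invr_ge0 normr_ge0 /= -exprS.
have rk : r ^+ k.+1 <= r by rewrite exprS ler_piMr // exprn_ile1 // ltW.
have d0 : 0 < 1 - r ^+ k.+1.
  by rewrite subr_gt0; apply: le_lt_trans rk p1.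
apply: (@le_trans _ _ (1 - r ^+ k.+1)^-1).
  rewrite lef_pV2 ?posrE //; last by rewrite normr_gt0 one_subX_neq0.
  by rewrite -normrX -[X in X - _]normr1; apply: lerB_dist.
have -> : (1 - r ^+ k.+1)^-1 = 1 + r ^+ k.+1 / (1 - r ^+ k.+1).
  by rewrite -{2}[1](mulfV (lt0r_neq0 d0)) -mulrDl subrK mul1r.
rewrite lerD2l mulrAC -exprS ler_wpM2l ?exprn_ge0 //.
by rewrite lef_pV2 ?posrE // lerD2l lerN2.
Qed.

Lemma qpoch_cvg a p : `|p| < 1 -> qpoch a p n @[n --> \oo] --> qpoch_inf a p.
Proof.
move=> p1; apply: K_complete => e e0.
have [M M0 hM] := qpoch_bounded a p1.
set r := `|p|; have r0 : 0 <= r by exact: normr_ge0.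
have r1' : 0 < 1 - r by rewrite subr_gt0.
(* The increments are at most [M |a| r^n]; division by [1 - r] lets the bounds telescope to
   [D (r^n - r^(n+d))]. *)
pose D := M * `|a| / (1 - r).
have D0 : 0 <= D by rewrite divr_ge0 ?mulr_ge0 // ltW.
have step n d : `|qpoch a p (n + d) - qpoch a p n| <= D * (r ^+ n - r ^+ (n + d)).
  elim: d => [|d IH]; first by rewrite addn0 !subrr normr0 mulr0.
  have -> : qpoch a p (n + d.+1) - qpoch a p n =
     (qpoch a p (n + d) - qpoch a p n) - qpoch a p (n + d) * a * p ^+ (n + d).
    by rewrite addnS qpochS; ring.
  apply: le_trans (ler_normB _ _) _.
  have -> : D * (r ^+ n - r ^+ (n + d.+1)) =
     D * (r ^+ n - r ^+ (n + d)) + M * `|a| * r ^+ (n + d).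
    rewrite addnS exprS.
    have <- : D * (1 - r) = M * `|a| by rewrite /D divfK // lt0r_neq0.
    ring.
  apply: lerD => //; rewrite !normrM normrX.
  by rewrite ler_wpM2r ?exprn_ge0 // ler_wpM2r.
have [n0 hn0] : exists n, r ^+ n <= e / (2 * (1 + D)).
  by apply: expr_small => //; rewrite divr_gt0 // mulr_gt0 // ltr_pwDl.
have close i : (n0 <= i)%N -> `|qpoch a p i - qpoch a p n0| <= e / 2.
  move=> lei; rewrite -(subnKC lei); apply: le_trans (step _ _) _.
  apply: (@le_trans _ _ (D * r ^+ n0)).
    by rewrite ler_wpM2l // lerBlDr lerDl exprn_ge0.
  apply: le_trans (ler_wpM2l D0 hn0) _.
  have -> : D * (e / (2 * (1 + D))) = e / 2 * (D / (1 + D)) by rewrite invfM; ring.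
  rewrite ler_piMr //.
    by rewrite divr_ge0 // ltW.
  by rewrite ler_pdivrMr ?ltr_pwDl // mul1r lerDr.
exists [set n | (n0 <= n)%N]; first by exists n0.
move=> i j /= hi hj.
have -> : qpoch a p i - qpoch a p j = (qpoch a p i - qpoch a p n0) - (qpoch a p j - qpoch a p n0).
  by ring.
by rewrite [e]splitr; apply: le_trans (ler_normB _ _) _; apply: lerD; apply: close.
Qed.

(** The reciprocals of the finite products are bounded, so the products stay away from 0. *)
Lemma qpoch_inf_neq0 p : `|p| < 1 -> qpoch_inf p p != 0.
Proof.
move=> p1; have [M M0 hM] := inv_qpoch_bounded p1.
apply/eqP => lim0; have /cvgrPdistC_le := @qpoch_cvg p p p1.
have d0 : 0 < (2 * (1 + M))^-1 by rewrite invr_gt0 mulr_gt0 // ltr_pwDl.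
move=> /(_ _ d0) [n _ /(_ n (leqnn n))] /=; rewrite lim0 subr0 => h.
have Pn0 : qpoch p p n != 0 by apply: qpoch_neq0 => k; apply: one_subX_neq0.
suff : (1 : K) < 1 by rewrite ltxx.
have {1}-> : 1 = `|qpoch p p n| * `|inv_qpoch p n|.
  by rewrite /= -normrM mulfV // normr1.
apply: (@le_lt_trans _ _ ((2 * (1 + M))^-1 * M)); first exact: ler_pM.
rewrite mulrC ltr_pdivrMr ?mulr_gt0 ?ltr_pwDl // mul1r mulrDr mulr1.
have -> : M = 0 + M by rewrite add0r.
by rewrite ltr_leD // add0r mulr_natl mulr2n lerDl.
Qed.

Lemma cvg_inv_qpoch p (z : int) : `|p| < 1 ->
  inv_qpoch p (n%:Z + z) @[n --> \oo] --> (qpoch_inf p p)^-1.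
Proof.
move=> p1; have Pinf := qpoch_inf_neq0 p1.
have h : (qpoch p p n)^-1 @[n --> \oo] --> (qpoch_inf p p)^-1.
  exact: (cvgV Pinf (@qpoch_cvg p p p1)).
apply/cvgrPdistC_le => e e0; have /cvgrPdistC_le /(_ _ e0) [n0 _ hn0] := h.
exists (n0 + `|z|)%N => // n /= hn.
have E : n%:Z + z = `|(n%:Z + z)%R|%N%:Z by lia.
by rewrite E; apply: hn0 => /=; lia.
Qed.

End InfiniteProducts.

Arguments qpoch_cvg [K] _ _ a [p] _.

(** * Families with bounded finite sums *)

Section AbsBounded.
Context (K : numFieldType).

Lemma abs_bounded_le (I : choiceType) (F G : I -> K) C M : 0 <= C ->
  (forall i, `|F i| <= C * `|G i|) -> abs_bounded G M -> abs_bounded F (C * M).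
Proof.
move=> C0 FG GM A; apply: (@le_trans _ _ (\sum_(i <- A) C * `|G i|)).
  exact: ler_sum.
by rewrite -mulr_sumr ler_wpM2l.
Qed.

Lemma abs_bounded_inj (I J : choiceType) (h : J -> I) (F : I -> K) M :
  injective h -> abs_bounded F M -> abs_bounded (F \o h) M.
Proof.
move=> hI FM A; apply: le_trans (FM (h @` A)%fset).
by rewrite big_imfset //= => x y _ _; apply: hI.
Qed.

(** A finite set of pairs lies in the product of its projections, over which the sum factors. *)
Lemma abs_bounded_prod (I J : choiceType) (F : I -> K) (G : J -> K) M N :
  abs_bounded F M -> abs_bounded G N ->
  abs_bounded (fun x : I * J => F x.1 * G x.2) (M * N).
Proof.
move=> FM GN A.
pose A1 := [fset x.1 | x in A]%fset; pose A2 := [fset x.2 | x in A]%fset.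
apply: (@le_trans _ _ ((\sum_(i <- A1) `|F i|) * (\sum_(j <- A2) `|G j|))); last first.
  by apply: ler_pM => //; apply: sumr_ge0.
have sA : (A `<=` A1 `*` A2)%fset.
  apply/fsubsetP => -[i j] h; rewrite in_fsetM /=; apply/andP; split.
    by apply/imfsetP; exists (i, j).
  by apply/imfsetP; exists (i, j).
rewrite big_distrlr /=.
have -> : \sum_(i <- A1) \sum_(j <- A2) `|F i| * `|G j| =
    \sum_(x <- (A1 `*` A2)%fset) `|F x.1 * G x.2|.
  rewrite (perm_big [seq (i, j) | i <- A1, j <- A2]) /=.
    by rewrite big_allpairs /=; apply: eq_bigr => i _; apply: eq_bigr => j _; rewrite normrM.
  apply: uniq_perm; first exact: fset_uniq.
    by apply: allpairs_uniq => // -[? ?] [? ?] _ _ /= [-> ->].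
  move=> [i j]; rewrite in_fsetM /=; apply/andP/allpairsP => [[hi hj]|[[i' j'] /= [hi hj [-> ->]]]] //.
  by exists (i, j).
rewrite (sum_fsetD (fun x => `|F x.1 * G x.2|) sA) lerDl.
exact: sumr_ge0.
Qed.

Lemma abs_bounded_geometric (r : K) : 0 <= r -> r < 1 ->
  abs_bounded (fun n : nat => r ^+ n) (1 - r)^-1.
Proof.
move=> r0 r1 A; have r1' : 0 < 1 - r by rewrite subr_gt0.
have geo n : \sum_(k < n) r ^+ k <= (1 - r)^-1.
  rewrite -[leRHS]mul1r ler_pdivlMr // mulrC -[X in X - r]expr1.
  suff -> : (1 ^+ 1 - r) * \sum_(k < n) r ^+ k = 1 - r ^+ n.
    by rewrite lerBlDr lerDl exprn_ge0.
  elim: n => [|n IH]; first by rewrite big_ord0 expr0 subrr mulr0.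
  by rewrite big_ord_recr /= mulrDr IH expr1n exprS; ring.
pose n := (\max_(k <- A) k).+1.
apply: le_trans (geo n).
rewrite -(big_mkord xpredT (fun k => r ^+ k)) /index_iota subn0.
under [leLHS]eq_bigr => k _ do rewrite /= normrX ger0_norm //.
have sub k : k \in A -> (k < n)%N.
  by move=> kA; rewrite /n ltnS; exact: (@leq_bigmax_seq _ (enum_fset A) xpredT id).
clearbody n.
rewrite [leRHS](bigID (mem A)) /= -[leLHS]addr0; apply: lerD; last first.
  by apply: sumr_ge0 => k _; apply: exprn_ge0.
rewrite -[leRHS]big_filter le_eqVlt; apply/orP; left; apply/eqP; apply: perm_big.
apply: uniq_perm; rewrite ?filter_uniq ?iota_uniq ?fset_uniq // => k.
rewrite mem_filter mem_iota /= add0n; case: (boolP (k \in A)) => // kA.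
by rewrite (sub _ kA).
Qed.

End AbsBounded.

(** * The complex numbers are Archimedean and complete *)

Section ComplexComplete.

Lemma cvg_of_dist (K : numFieldType) (I : Type) (F : set_system I) (u : I -> K) :
  ProperFilter F ->
  (exists l, forall e, 0 < e -> exists2 A, F A & forall i, A i -> `|l - u i| <= e) ->
  cvg (u @ F).
Proof.
move=> FF [l hl]; apply/cvg_ex; exists l; apply/cvgrPdist_le => e e0.
have [A FA hA] := hl e e0; exact: filterS FA.
Qed.

Lemma real_cauchy_complete (R : realType) (I : Type) (F : set_system I) (v : I -> R) :
  ProperFilter F ->
  (forall e, 0 < e -> exists2 A, F A & forall i j, A i -> A j -> `|v i - v j| <= e) ->
  exists l, forall e, 0 < e -> exists2 A, F A & forall i, A i -> `|l - v i| <= e.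
Proof.
move=> FF hv.
have /cvg_ex[l hl] : cvg (v @ F).
  apply: R_complete; apply: cauchy_exP => e e0.
  have [A FA hA] := hv _ (divr_gt0 e0 (ltr0n R 2)).
  have [i Ai] := filter_ex FA.
  exists (v i); suff : F (v @^-1` ball (v i) e) by [].
  apply: filterS FA => j Aj; rewrite /preimage /= -ball_normE /=.
  by apply: le_lt_trans (hA i j Ai Aj) _; rewrite ltr_pdivrMr // ltr_pMr // ltr1n.
exists l => e e0; move/cvgrPdist_le: hl => /(_ e e0) h.
by exists (fun i => `|l - v i| <= e).
Qed.

Context (R : realType).
Local Notation C := (R[i] : numFieldType).

Lemma complex_archimedean : archimedean_field C.
Proof.
case=> a b; rewrite lecE /= => /andP[/eqP b0 a0].
exists (Num.bound a); rewrite lecE /=.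
have -> : ((Num.bound a)%:R : R[i]) = ((Num.bound a)%:R)%:C by rewrite rmorph_nat.
by rewrite /= b0 eqxx /= ltW // archi_boundP.
Qed.

Lemma ler_normc_Re (z : R[i]) : (`|complex.Re z|)%:C <= `|z|.
Proof.
rewrite normc_def lecR -sqrtr_sqr ler_wsqrtr // lerDl; exact: sqr_ge0.
Qed.

Lemma ler_normc_Im (z : R[i]) : (`|complex.Im z|)%:C <= `|z|.
Proof.
rewrite normc_def lecR -sqrtr_sqr ler_wsqrtr // lerDr; exact: sqr_ge0.
Qed.

Lemma ler_normc_ReIm (z : R[i]) :
  `|z| <= (`|complex.Re z|)%:C + (`|complex.Im z|)%:C.
Proof.
rewrite -rmorphD normc_def lecR -[leRHS]ger0_norm ?addr_ge0 // -sqrtr_sqr.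
rewrite ler_wsqrtr // sqrrD !real_normK ?num_real //.
by rewrite lerD2r lerDl mulrn_wge0 // mulr_ge0.
Qed.

Lemma complex_cauchy_complete : cauchy_complete C.
Proof.
move=> I F u FF hu; apply: cvg_of_dist.
have gt0 (e : R) : 0 < e -> (0 : R[i]) < e%:C by rewrite ltcR.
have [a ha] : exists a, forall e, 0 < e ->
    exists2 A, F A & forall i, A i -> `|a - complex.Re (u i)| <= e.
  apply: real_cauchy_complete => e /gt0/hu [A FA hA]; exists A => // i j Ai Aj.
  rewrite -lecR; apply: le_trans (hA i j Ai Aj); rewrite -raddfB; exact: ler_normc_Re.
have [b hb] : exists b, forall e, 0 < e ->
    exists2 A, F A & forall i, A i -> `|b - complex.Im (u i)| <= e.
  apply: real_cauchy_complete => e /gt0/hu [A FA hA]; exists A => // i j Ai Aj.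
  rewrite -lecR; apply: le_trans (hA i j Ai Aj); rewrite -raddfB; exact: ler_normc_Im.
(* A positive complex number is real, so the imaginary part of the tolerance is 0. *)
exists (a +i* b) => -[e e'] /=; rewrite ltcE /= => /andP[/eqP-> e0].
have e2 : 0 < e / 2 by rewrite divr_gt0.
have [A FA hA] := ha _ e2; have [B FB hB] := hb _ e2.
exists (A `&` B); first exact: filterI.
move=> i [Ai Bi]; apply: le_trans (ler_normc_ReIm _) _.
rewrite -rmorphD -[_ +i* 0]/(e%:C) lecR [e]splitr.
have hA' := hA i Ai; have hB' := hB i Bi.
by move: hA' hB'; case: (u i) => x y /= hA' hB'; apply: lerD.
Qed.

End ComplexComplete.

(** * The limit *)

Section JacobiWeights.
Context (K : numFieldType).

Definition jac (j : int) : K := (jacobi3 (j + 1))%:~R.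

Lemma jacobi3_sum3 (j : int) : jacobi3 (j + 1) + jacobi3 j + jacobi3 (j - 1) = 0.
Proof.
rewrite /jacobi3; have := ltz_pmod j (isT : 0 < 3%:Z); have := modz_ge0 j (isT : 3%:Z != 0).
have Ej := divz_eq j 3; set r := (j %% 3)%Z in Ej * => r0 r3.
have E1 : ((j + 1) %% 3)%Z = ((r + 1) %% 3)%Z by rewrite {1}Ej -addrA modzMDl.
have E2 : ((j - 1) %% 3)%Z = ((r - 1) %% 3)%Z by rewrite {1}Ej -addrA modzMDl.
rewrite E1 E2; clear -r0 r3.
have [->|[->|->]] : r = 0 \/ r = 1 \/ r = 2 by lia.
all: by [].
Qed.

Lemma jac_rec j : jac (j + 1) + jac j + jac (j - 1) = 0.
Proof.
rewrite /jac -!intrD.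
have -> : j - 1 + 1 = j + 1 - 1 by lia.
by rewrite jacobi3_sum3.
Qed.

Lemma jac0 : jac 0 = 1.
Proof. by []. Qed.

Lemma norm_jac j : `|jac j| <= 1.
Proof.
rewrite /jac /jacobi3; case: eqP => _; first by rewrite normr0.
by case: eqP => _; rewrite ?normrN ?normr1.
Qed.

End JacobiWeights.

(** * The summand of the multisum as a Bailey chain *)

Section MultisumTerm.
Context (K : numFieldType) (q : K).
Local Notation e := (inv_qpoch q).

(** Links the recursive form, suited to iterating the Bailey lemma, with the indexed form of
    [multisum_term]. *)
Lemma chainE_nth (b : nat -> K) s : s != [::] -> chain q b s =
  q ^+ (\sum_(1 <= i < (size s).+1) (\sum_(i <= j < (size s).+1) nth 0 s j.-1) ^ 2)
  * (\prod_(1 <= i < size s) e (nth 0%N s i.-1)%:Z) * b (last 0%N s).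
Proof.
elim: s => // n s IH _; case: s IH => [|m s] IH.
  by rewrite /= big_nat1 big_nat1 /= big_geq // mulr1.
rewrite [chain q b _]/= -/(chain q b (m :: s)) IH //.
set t := m :: s.
have St : (size t > 0)%N by [].
have Et : (m + sumn s)%N = sumn t by [].
have El : last 0%N t = last n t by [].
clearbody t.
have E1 : (\sum_(1 <= i < (size t).+2) (\sum_(i <= j < (size t).+2) nth 0 (n :: t) j.-1) ^ 2
   = (n + sumn t) ^ 2
     + \sum_(1 <= i < (size t).+1) (\sum_(i <= j < (size t).+1) nth 0 t j.-1) ^ 2)%N.
  rewrite big_ltn //; congr (_ ^ 2 + _)%N.
    rewrite big_ltn //= big_add1 /= big_add1 /=; congr (_ + _)%N.
    by rewrite sumnE [RHS](big_nth 0%N).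
  rewrite big_add1 /=; apply: eq_big_nat => i /andP[i1 _]; congr (_ ^ 2)%N.
  rewrite big_add1 /=; apply: eq_big_nat => j /andP[ij _].
  by case: j ij => [|j] // ij; move: i1 ij; case: i.
have E2 : \prod_(1 <= i < (size t).+1) e (nth 0%N (n :: t) i.-1)%:Z
    = e n%:Z * \prod_(1 <= i < size t) e (nth 0%N t i.-1)%:Z.
  rewrite big_ltn // big_add1 /=; congr (_ * _).
  by apply: eq_big_nat => -[|i] //.
rewrite [size (n :: t)]/= E1 E2 exprD [last _ (n :: t)]/= El Et; ring.
Qed.

(** The [(m, n)] summand of the beta sequence of the Bailey pair; the factors [(q)_l] and
    [1/(q)_(2l)] of the multisum, at [l = n_f], belong to it. *)
Definition seed (m n l : nat) : K :=
  capp_term q m n * e (l%:Z - 3 * n%:Z - 2 * m%:Z) * qpoch q q l * e (2 * l)%N%:Z.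

Lemma multisum_term_chain (f : nat) (m n : nat) (ns : f.-tuple nat) : (0 < f)%N ->
  multisum_term q (m, n, ns) = chain q (seed m n) ns.
Proof.
move=> f0.
have sn : size ns = f by rewrite size_tuple.
have ns0 : tval ns != [::] by rewrite -size_eq0 sn -lt0n.
rewrite (chainE_nth _ ns0) sn /multisum_term /seed /capp_term /tail_sum /part.
rewrite (_ : last 0%N ns = nth 0%N ns f.-1); last by rewrite -nth_last sn.
have eE (p : K) k : inv_qpoch p k%:Z = (qpoch p p k)^-1 by [].
have -> : \prod_(1 <= i < f) e (nth 0%N ns i.-1)%:Z =
  \prod_(1 <= i < f) (qpoch q q (nth 0%N ns i.-1))^-1 by [].
rewrite !eE prodfV exprD !invfM; ring.
Qed.

End MultisumTerm.

Section FsetOfSeq.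
Context (K : numFieldType).

Lemma mem_seq_fset (I : choiceType) (s : seq I) x :
  (x \in [fset x in s]%fset) = (x \in s).
Proof. by rewrite !inE. Qed.

Lemma sum_seq_fset (I : choiceType) (s : seq I) (F : I -> K) : uniq s ->
  \sum_(x <- [fset x in s]%fset) F x = \sum_(x <- s) F x.
Proof.
move=> us; apply: perm_big; apply: uniq_perm => // x.
exact: mem_seq_fset.
Qed.

Definition zint_seq (N : nat) : seq int := [seq i%:Z - N%:Z | i <- index_iota 0 (2 * N).+1].

Lemma zsum_fset N (F : int -> K) : \sum_(j <- [fset j in zint_seq N]%fset) F j = zsum N F.
Proof.
rewrite sum_seq_fset; first by rewrite /zsum big_map big_mkord.
by rewrite map_inj_uniq ?iota_uniq // => i j; lia.
Qed.

Lemma mem_zint_seq N j : (`|j| <= N)%N -> j \in zint_seq N.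
Proof.
move=> hj; apply/mapP; exists `|(j + N%:Z)%R|%N; last by lia.
by rewrite mem_index_iota; lia.
Qed.

End FsetOfSeq.

(** * Convergence of the theta series *)

Section ThetaLimit.
Context (K : numFieldType).
Hypothesis K_archi : archimedean_field K.
Hypothesis K_complete : cauchy_complete K.
Context (q : K) (f : nat).
Hypothesis q1 : `|q| < 1.

Let normqX_le a b : (a <= b)%N -> `|q| ^+ b <= `|q| ^+ a.
Proof. by move=> leab; apply: ler_wiXn2l => //; apply: ltW. Qed.

Lemma theta_abs_bounded : exists M, abs_bounded (theta_term q f) M.
Proof.
(* Nonnegative and negative [j] go to different axes, so that a product of two geometric series
   dominates. *)
pose h (j : int) : nat * nat := if 0 <= j then (`|j|%N, 0%N) else (0%N, `|j|%N).
have hI : injective h by move=> i j; rewrite /h; case: ifP; case: ifP => ? ? []; lia.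
have geo := abs_bounded_geometric (normr_ge0 q) q1.
have := abs_bounded_inj hI (abs_bounded_prod geo geo) => bd.
exists (1 * ((1 - `|q|)^-1 * (1 - `|q|)^-1)).
apply: abs_bounded_le bd => // j; rewrite mul1r /theta_term normrM.
apply: (@le_trans _ _ (1 * `|q| ^+ `|j|)).
  apply: ler_pM => //; first exact: norm_jac.
  by rewrite normrX; apply: normqX_le; nia.
rewrite mul1r /h /=; case: ifP => _ /=; rewrite expr0 ?mulr1 ?mul1r normrX normr_id //.
Qed.

(** The base [p] is separate from [q] because the limit is taken twice: with [p = q] for the
    multisum and with [p = Q^2], [Q = q^(f+1)], for the product formula. *)
Lemma theta_tannery p (P : nat -> K) : `|p| < 1 ->
  (forall L, P L = zsum L.+2 (fun j => theta_term q f j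
      * (inv_qpoch p (L%:Z - j) * inv_qpoch p (L%:Z + j)))) ->
  P L @[L --> \oo] --> usum (theta_term q f) * ((qpoch_inf p p)^-1 * (qpoch_inf p p)^-1).
Proof.
move=> p1 hP; have [M bd] := theta_abs_bounded.
have [Ce Ce0 hCe] := inv_qpoch_bounded K_archi p1.
have -> : P = fun L => \sum_(j <- [fset j in zint_seq L.+2]%fset) theta_term q f j
      * (inv_qpoch p (L%:Z - j) * inv_qpoch p (L%:Z + j)).
  by apply/funext => L; rewrite zsum_fset hP.
apply: (@tannery K int K_archi K_complete _ M (fun L => [fset j in zint_seq L.+2]%fset)
  (fun L j => inv_qpoch p (L%:Z - j) * inv_qpoch p (L%:Z + j)) _ (Ce * Ce)) => //.
- by rewrite mulr_ge0.
- move=> j; exists `|j|%N => // n /= hn; rewrite mem_seq_fset; apply: mem_zint_seq; lia.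
- by move=> j; apply: cvgM; exact: cvg_inv_qpoch.
- by move=> n j; rewrite normrM; apply: ler_pM.
Qed.

End ThetaLimit.

(** * The product formula for the theta series *)

Section ThetaProduct.
Context (K : numFieldType).
Hypothesis K_archi : archimedean_field K.
Hypothesis K_complete : cauchy_complete K.

Lemma cvg_qpoch_muln a (p : K) k : (0 < k)%N -> `|p| < 1 ->
  qpoch a p (k * n) @[n --> \oo] --> qpoch_inf a p.
Proof.
move=> k0 p1; apply/cvgrPdistC_le => e e0.
have /cvgrPdistC_le /(_ _ e0) [n0 _ hn0] := qpoch_cvg K_archi K_complete a p1.
by exists n0 => // n /= hn; apply: hn0 => /=; nia.
Qed.

Arguments cvg_qpoch_muln a [p k] _ _.

Lemma qpoch_double a (p : K) n :
  qpoch a p (2 * n) = qpoch a (p ^+ 2) n * qpoch (a * p) (p ^+ 2) n.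
Proof.
elim: n => [|n IH]; first by rewrite muln0 !qpoch0 mulr1.
rewrite mulnS add2n !qpochS IH -!exprM (exprS p (2 * n)); ring.
Qed.

Lemma qpoch_triple a (p : K) n : qpoch a p (3 * n) =
  qpoch a (p ^+ 3) n * qpoch (a * p) (p ^+ 3) n * qpoch (a * p ^+ 2) (p ^+ 3) n.
Proof.
elim: n => [|n IH]; first by rewrite muln0 !qpoch0 !mulr1.
rewrite mulnS addSn add2n !qpochS IH -!exprM !(exprS p (3 * n).+1) !(exprS p (3 * n)).
ring.
Qed.

Lemma qpoch_opp (p : K) n :
  qpoch p p n * qpoch (- p) p n = qpoch (p ^+ 2) (p ^+ 2) n.
Proof.
elim: n => [|n IH]; first by rewrite !qpoch0 mulr1.
by rewrite !qpochS -IH exprAC; ring.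
Qed.

Lemma cvg_eq (u v : nat -> K) (a b : K) :
  u n @[n --> \oo] --> a -> v n @[n --> \oo] --> b -> (forall n, u n = v n) -> a = b.
Proof.
move=> ua vb uv; have E : u = v by apply/funext.
rewrite E in ua.
by have := norm_cvg_lim ua; have := norm_cvg_lim vb; move=> <- <-.
Qed.

Lemma theta_product (q : K) (f : nat) : `|q| < 1 ->
  let Q := q ^+ f.+1 in
  usum (theta_term q f) =
  qpoch_inf Q Q * qpoch_inf (- Q ^+ 3) (Q ^+ 3)
  * (qpoch_inf (- Q ^+ 2) (Q ^+ 6) * qpoch_inf (- Q ^+ 4) (Q ^+ 6)).
Proof.
move=> q1 Q.
have Q1 : `|Q| < 1 by rewrite normrX exprn_ilt1.
have QX k : `|Q ^+ k.+1| < 1 by rewrite normrX exprn_ilt1.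
set p := Q ^+ 2; have p1 : `|p| < 1 by exact: QX.
have p_neq1 k : 1 - p ^+ k.+1 != 0 by exact: one_subX_neq0.
have pinf := qpoch_inf_neq0 K_archi K_complete p1.
have cvq a k := qpoch_cvg K_archi K_complete a (QX k).
have cvq1 a := qpoch_cvg K_archi K_complete a Q1.
pose X n := \prod_(k < n) (1 - Q ^+ (2 * k).+1 + (Q ^+ (2 * k).+1) ^+ 2).
pose T := usum (theta_term q f).
(* [X] is [(p;p)_(2n)] times the finite theta sum; the prefactor cancels one of the two factors
   [1/(p;p)_oo] in the limit. *)
have limX : X n @[n --> \oo] --> T * (qpoch_inf p p)^-1.
  have h1 : theta_sum Q (@jac K) L.+2 L @[L --> \oo] -->
      T * ((qpoch_inf p p)^-1 * (qpoch_inf p p)^-1).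
    apply: (theta_tannery K_archi K_complete q1 p1) => L; apply: eq_zsum => j.
    by rewrite /theta_term /Q -exprM mulrA.
  have h2 := cvg_qpoch_muln p (isT : (0 < 2)%N) p1.
  have -> : T * (qpoch_inf p p)^-1 =
      qpoch_inf p p * (T * ((qpoch_inf p p)^-1 * (qpoch_inf p p)^-1)).
    by field.
  have -> : X = fun L => qpoch p p (2 * L) * theta_sum Q (@jac K) L.+2 L.
    by apply/funext => L; rewrite theta_sum_prod ?jac0 ?mul1r //; exact: jac_rec.
  exact: cvgM h2 h1.
clearbody Q.
(* Factor by factor, [(1 - x + x^2) (1 + x) = 1 + x^3] for [x = Q^(2k+1)]. *)
have XE : T * (qpoch_inf p p)^-1 * qpoch_inf (- Q) p = qpoch_inf (- Q ^+ 3) (Q ^+ 6).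
  apply: (cvg_eq (cvgM limX (cvq (- Q) 1%N)) (cvq (- Q ^+ 3) 5%N)) => n /=.
  rewrite /X; elim: n => [|n IH]; first by rewrite big_ord0 !qpoch0 mulr1.
  rewrite big_ord_recr !qpochS /= mulrACA IH; congr (_ * _).
  have -> : (Q ^+ 2) ^+ n = Q ^+ (2 * n) by rewrite exprM.
  have -> : (Q ^+ 6) ^+ n = (Q ^+ (2 * n)) ^+ 3 by rewrite -!exprM; congr (Q ^+ _); lia.
  by rewrite exprS; ring.
have E3 : qpoch_inf (- Q ^+ 3) (Q ^+ 3) =
    qpoch_inf (- Q ^+ 3) (Q ^+ 6) * qpoch_inf (- Q ^+ 6) (Q ^+ 6).
  apply: (cvg_eq (cvg_qpoch_muln (- Q ^+ 3) (isT : (0 < 2)%N) (QX 2%N))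
    (cvgM (cvq (- Q ^+ 3) 5%N) (cvq (- Q ^+ 6) 5%N))) => n /=.
  by rewrite qpoch_double mulNr -exprD -exprM.
have E2 : qpoch_inf (- Q ^+ 2) (Q ^+ 2) = qpoch_inf (- Q ^+ 2) (Q ^+ 6)
    * qpoch_inf (- Q ^+ 4) (Q ^+ 6) * qpoch_inf (- Q ^+ 6) (Q ^+ 6).
  apply: (cvg_eq (cvg_qpoch_muln (- Q ^+ 2) (isT : (0 < 3)%N) (QX 1%N))
    (cvgM (cvgM (cvq (- Q ^+ 2) 5%N) (cvq (- Q ^+ 4) 5%N)) (cvq (- Q ^+ 6) 5%N))) => n /=.
  by rewrite qpoch_triple !mulNr -!exprM -!exprD.
have E1 : qpoch_inf (- Q) Q = qpoch_inf (- Q) p * qpoch_inf (- Q ^+ 2) p.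
  apply: (cvg_eq (cvg_qpoch_muln (- Q) (isT : (0 < 2)%N) Q1)
    (cvgM (cvq (- Q) 1%N) (cvq (- Q ^+ 2) 1%N))) => n /=.
  by rewrite qpoch_double mulNr -expr2.
have E0 : qpoch_inf Q Q * qpoch_inf (- Q) Q = qpoch_inf p p.
  apply: (cvg_eq (cvgM (cvq1 Q) (cvq1 (- Q))) (cvq (Q ^+ 2) 1%N)) => n /=.
  exact: qpoch_opp.
(* [T] is the limit of [X] times [(p;p)_oo = (Q;Q)_oo (-Q;p)_oo (-Q^2;p)_oo]. The factor [(-Q;p)_oo]
   joins the limit of [X] by [XE], and [(-Q^6;Q^6)_oo] from [E2] completes [(-Q^3;Q^3)_oo]. *)
rewrite -/T E3 -XE.
rewrite -[LHS](mulfVK pinf) -[X in _ * X = _]E0 E1 [qpoch_inf (- Q ^+ 2) p]E2 /p; ring.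
Qed.

End ThetaProduct.

(** * Convergence and value of the multisum *)

Section MultisumLimit.
Context (K : numFieldType).
Hypothesis K_archi : archimedean_field K.
Hypothesis K_complete : cauchy_complete K.
Context (q : K).
Hypothesis q1 : `|q| < 1.
Local Notation e := (inv_qpoch q).

Let q_neq1 k : 1 - q ^+ k.+1 != 0.
Proof. exact: one_subX_neq0. Qed.

Let normqX_le a b : (a <= b)%N -> `|q| ^+ b <= `|q| ^+ a.
Proof. by move=> leab; apply: ler_wiXn2l => //; apply: ltW. Qed.

Lemma tuple_abs_bounded f :
  exists M, abs_bounded (fun ns : f.-tuple nat => `|q| ^+ sumn ns) M.
Proof.
elim: f => [|f [M IH]].
  exists 1 => A; have [->|/fset0Pn[x xA]] := eqVneq A fset0.
    by rewrite big_seq_fset0.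
  have -> : A = [fset x]%fset.
    by apply/fsetP => y; rewrite !inE (tuple0 y) (tuple0 x) eqxx -(tuple0 x).
  by rewrite big_seq_fset1 (tuple0 x) /= expr0 normr1.
have geo := abs_bounded_geometric (normr_ge0 q) q1.
pose h (ns : f.+1.-tuple nat) := (thead ns, [tuple of behead ns]).
have hI : injective h.
  move=> s t; rewrite [s]tuple_eta [t]tuple_eta => -[h1 h2]; apply/val_inj => /=.
  by move: h1 h2; rewrite /thead !tnth0 /= => -> ->.
exists (1 * ((1 - `|q|)^-1 * M)).
apply: abs_bounded_le (abs_bounded_inj hI (abs_bounded_prod geo IH)) => // ns.
by rewrite mul1r /= [ns]tuple_eta /= -exprD /thead tnth0.
Qed.

(** Each square [N_i^2] is at least [n_i]. The assumption [1 <= Ce] pays for the last index, which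
    has no factor [inv_qpoch]. *)
Lemma chain_bound Ce : 1 <= Ce -> (forall k, `|e k| <= Ce) ->
  forall s, `|chain q (fun=> 1) s| <= Ce ^+ size s * `|q| ^+ sumn s.
Proof.
move=> Ce1 hCe; have Ce0 : 0 <= Ce by apply: le_trans Ce1.
elim=> [|n s IH]; first by rewrite /= normr1 !expr0 mulr1.
case: s IH => [|m s] IH.
  rewrite /= mulr1 normrX addn0 expr1 -[leLHS]mul1r.
  by apply: ler_pM; rewrite ?exprn_ge0 //; apply: normqX_le; nia.
rewrite [chain _ _ _]/= -/(chain q (fun=> 1) (m :: s)) !normrM.
have -> : Ce ^+ size [:: n, m & s] * `|q| ^+ sumn [:: n, m & s] =
    `|q| ^+ n * Ce * (Ce ^+ size (m :: s) * `|q| ^+ sumn (m :: s)).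
  by rewrite [size _]/= [sumn (n :: _)]/= (exprS Ce) exprD; ring.
apply: ler_pM; rewrite ?mulr_ge0 //; apply: ler_pM => //.
by rewrite normrX; apply: normqX_le; nia.
Qed.

Lemma seed_bound : exists2 C : K, 0 <= C &
  forall m n l, `|seed q m n l| <= C * (`|q| ^+ m * `|q| ^+ n).
Proof.
have q31 : `|q ^+ 3| < 1 by rewrite normrX exprn_ilt1.
have [Ce Ce0 hCe] := inv_qpoch_bounded K_archi q1.
have [C3 C30 hC3] := inv_qpoch_bounded K_archi q31.
have [Cq Cq0 hCq] := qpoch_bounded K_archi q q1.
exists (Ce * C3 * Ce * Cq * Ce) => [|m n l]; first by rewrite !mulr_ge0.
rewrite /seed /capp_term !normrM.
have -> : Ce * C3 * Ce * Cq * Ce * (`|q| ^+ m * `|q| ^+ n) =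
  `|q| ^+ (m + n) * Ce * C3 * Ce * Cq * Ce by rewrite exprD; ring.
do 5! [apply: ler_pM; rewrite ?mulr_ge0 //].
by rewrite normrX; apply: normqX_le; nia.
Qed.

Lemma multisum_abs_bounded f : (0 < f)%N ->
  exists M, abs_bounded (multisum_term q (f := f)) M.
Proof.
move=> f0; have [M bdt] := tuple_abs_bounded f.
have [Cs Cs0 hCs] := seed_bound.
have [Ce Ce0 hCe] := inv_qpoch_bounded K_archi q1.
have geo := abs_bounded_geometric (normr_ge0 q) q1.
have D1 : 1 <= 1 + Ce by rewrite lerDl.
have hD k : `|e k| <= 1 + Ce by apply: le_trans (hCe k) _; rewrite lerDr.
exists (Cs * (1 + Ce) ^+ f * ((1 - `|q|)^-1 * (1 - `|q|)^-1 * M)).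
apply: abs_bounded_le (abs_bounded_prod (abs_bounded_prod geo geo) bdt).
  by rewrite mulr_ge0 // exprn_ge0 // addr_ge0.
move=> [[m n] ns]; rewrite multisum_term_chain // chain_factor; last first.
  by rewrite -size_eq0 size_tuple -lt0n.
rewrite [leLHS]normrM /=.
have -> : `| (`|q| ^+ m * `|q| ^+ n * `|q| ^+ sumn ns) |
    = `|q| ^+ m * `|q| ^+ n * `|q| ^+ sumn ns.
  by rewrite ger0_norm // !mulr_ge0 // exprn_ge0.
have -> : Cs * (1 + Ce) ^+ f * (`|q| ^+ m * `|q| ^+ n * `|q| ^+ sumn ns) =
  (1 + Ce) ^+ f * `|q| ^+ sumn ns * (Cs * (`|q| ^+ m * `|q| ^+ n)) by ring.
by have := chain_bound D1 hD ns; rewrite size_tuple => h; apply: ler_pM.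
Qed.

(** The sequences in [box f B] all have size [f], so [insub] turns them into tuples without losing
    any. *)
Definition index_box (f B : nat) : seq (nat * nat * f.-tuple nat) :=
  [seq (mn, t) | mn <- [seq (m, n) | m <- index_iota 0 B, n <- index_iota 0 B],
                 t <- pmap insub (box f B)].

Lemma index_box_uniq f B : uniq (index_box f B).
Proof.
apply: allpairs_uniq; last by move=> [? ?] [? ?] _ _ /= [-> ->].
  apply: allpairs_uniq; rewrite ?iota_uniq //.
  by move=> [? ?] [? ?] _ _ /= [-> ->].
exact/pmap_sub_uniq/box_uniq.
Qed.

Lemma mem_index_box f B m n (ns : f.-tuple nat) :
  (m < B)%N -> (n < B)%N -> (sumn ns < B)%N -> (m, n, ns) \in index_box f B.
Proof.
move=> mB nB sB; apply/allpairsP; exists ((m, n), ns); split=> //=.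
  by apply/allpairsP; exists (m, n); rewrite !mem_index_iota.
rewrite mem_pmap_sub mem_box size_tuple eqxx /=; apply/allP => x xs.
by apply: leq_ltn_trans sB; rewrite sumnE (big_rem x) //= leq_addr.
Qed.

Lemma sum_pmap_box f B (G : seq nat -> K) :
  \sum_(t <- pmap (insub : seq nat -> option (f.-tuple nat)) (box f B)) G t
  = \sum_(s <- box f B) G s.
Proof.
rewrite -(big_map val xpredT G) (pmap_filter (insubK _)); congr bigop.
apply/all_filterP/allP => s; rewrite mem_box => /andP[sf _].
by rewrite isSome_insub.
Qed.

(** The multisum identity at finite level [L]. Indices up to [L] suffice: only [N_1 <= L]
    contributes, and the seed vanishes for [2m + 3n > n_f]. *)
Lemma multisum_box_sum f L : (0 < f)%N ->
  \sum_(x <- index_box f L.+1) multisum_term q x * e (L%:Z - (sumn x.2)%:Z)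
  = theta_level q (@jac K) L.+2 f.+1 L.
Proof.
move=> f0.
pose b l : K := \sum_(0 <= m < L.+1) \sum_(0 <= n < L.+1) seed q m n l.
have bE r : (r <= L)%N -> b r = theta_level q (@jac K) L.+2 1 r.
  move=> rL; rewrite theta_level1.
  have r2n0 : qpoch q q (2 * r) != 0 by apply: qpoch_neq0.
  apply: (mulfI r2n0); rewrite (theta_poly_capp q_neq1 (@jac_rec K) (jac0 K)); last by lia.
  have ltr : (r < L.+1)%N by [].
  rewrite -(capp_conv_box q ltr) /b big_mkord !mulr_sumr; apply: eq_bigr => m _.
  rewrite big_mkord !mulr_sumr; apply: eq_bigr => n _; rewrite /seed.
  have -> : e (2 * r)%N%:Z = (qpoch q q (2 * r))^-1 by [].
  by rewrite mulrC divfK // mulrC.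
rewrite -[f in RHS](prednK f0) -(chain_sum q_neq1 f.-1 (ltnSn L) bE) prednK //.
rewrite /index_box big_allpairs_dep big_allpairs_dep /=.
have E m n : \sum_(t <- pmap insub (box f L.+1))
      multisum_term q (m, n, t : f.-tuple nat) * e (L%:Z - (sumn t)%:Z) =
    \sum_(s <- box f L.+1) e (L%:Z - (sumn s)%:Z) * chain q (fun=> 1) s
       * seed q m n (last 0%N s).
  rewrite -sum_pmap_box; apply: eq_bigr => t _.
  rewrite multisum_term_chain // chain_factor; last by rewrite -size_eq0 size_tuple -lt0n.
  by rewrite mulrC mulrA.
under eq_bigr => m _ do under eq_bigr => n _ do rewrite E.
under eq_bigr => m _ do rewrite exchange_big /=.
rewrite exchange_big /= big_seq [RHS]big_seq; apply: eq_bigr => s.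
rewrite mem_box => /andP[/eqP sf _].
rewrite (chain_factor _ b); last by rewrite -size_eq0 sf -lt0n.
rewrite mulrA /b mulr_sumr; apply: eq_bigr => m _; by rewrite mulr_sumr.
Qed.

Lemma multisum_limit f : (0 < f)%N ->
  usum (multisum_term q (f := f)) = (qpoch_inf q q)^-1 * usum (theta_term q f).
Proof.
move=> f0; have [M bd] := multisum_abs_bounded f0.
have [Ce Ce0 hCe] := inv_qpoch_bounded K_archi q1.
have qinf := qpoch_inf_neq0 K_archi K_complete q1.
have h1 : (\sum_(x <- [fset x in index_box f L.+1]%fset)
      multisum_term q x * e (L%:Z - (sumn x.2)%:Z)) @[L --> \oo]
    --> usum (multisum_term q (f := f)) * (qpoch_inf q q)^-1.
  apply: (@tannery K _ K_archi K_complete _ M (fun L => [fset x in index_box f L.+1]%fset)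
    (fun L x => e (L%:Z - (sumn x.2)%:Z)) _ Ce) => //.
  - move=> [[m n] ns]; exists (m + n + sumn ns)%N => // L /= hL.
    by rewrite mem_seq_fset; apply: mem_index_box; lia.
  - by move=> x; exact: cvg_inv_qpoch.
have h2 : theta_level q (@jac K) L.+2 f.+1 L @[L --> \oo] -->
    usum (theta_term q f) * ((qpoch_inf q q)^-1 * (qpoch_inf q q)^-1).
  apply: (theta_tannery K_archi K_complete q1 q1) => L; apply: eq_zsum => j.
  by rewrite /theta_term mulrA.
(* The truncation weight [1/(q)_(L-N_1)] leaves one factor [1/(q;q)_oo] on the left, which cancels
   one of the two on the right. *)
suff E : usum (multisum_term q (f := f)) * (qpoch_inf q q)^-1 =
    usum (theta_term q f) * ((qpoch_inf q q)^-1 * (qpoch_inf q q)^-1).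
  by move: E; rewrite mulrA => /(mulIf (invr_neq0 qinf)) ->; exact: mulrC.
apply: (cvg_eq h1 h2) => L.
by rewrite sum_seq_fset ?index_box_uniq // multisum_box_sum.
Qed.

End MultisumLimit.

(** * Assembly of the two equalities over the complex numbers *)

Lemma theta_quotient (K : numFieldType) (q : K) (f : nat) :
  archimedean_field K -> cauchy_complete K -> `|q| < 1 ->
  1 / qpoch_inf q q * usum (theta_term q f)
  = qpoch_inf (q ^+ f.+1) (q ^+ f.+1) / qpoch_inf q q
    * qpoch_inf (- q ^+ (3 * f.+1)) (q ^+ (3 * f.+1))
    * (qpoch_inf (- q ^+ (2 * f.+1)) (q ^+ (6 * f.+1))
       * qpoch_inf (- q ^+ (4 * f.+1)) (q ^+ (6 * f.+1))).
Proof.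
move=> arch compl q1; have E k : q ^+ (k * f.+1) = (q ^+ f.+1) ^+ k.
  by rewrite mulnC exprM.
rewrite (theta_product arch compl f q1) /= !E; ring.
Qed.

Theorem theorem22 (R : realType) (f : nat) (q : R[i]) :
  (0 < f)%N -> `|q| < 1 ->
  [/\ has_usum (multisum_term q (f := f)),
      has_usum (theta_term q f),
      usum (multisum_term q (f := f))
        = 1 / qpoch_inf q q * usum (theta_term q f)
    & 1 / qpoch_inf q q * usum (theta_term q f)
        = qpoch_inf (q ^+ f.+1) (q ^+ f.+1) / qpoch_inf q q
          * qpoch_inf (- q ^+ (3 * f.+1)) (q ^+ (3 * f.+1))
          * (qpoch_inf (- q ^+ (2 * f.+1)) (q ^+ (6 * f.+1))
             * qpoch_inf (- q ^+ (4 * f.+1)) (q ^+ (6 * f.+1)))].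
Proof.
move=> f0 q1.
have arch := @complex_archimedean R; have compl := @complex_cauchy_complete R.
have [M1 bd1] := multisum_abs_bounded arch q1 f0.
have [M2 bd2] := theta_abs_bounded f q1.
split.
- exact: abs_bounded_has_usum bd1.
- exact: abs_bounded_has_usum bd2.
- by rewrite (multisum_limit arch compl q1 f0) div1r.
exact: (theta_quotient f arch compl q1).
Qed.
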